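(* Let $A$ be a unital filtered $A_\infty$-algebra. Then $A$ is quasi-isomorphic to the filtered dg-algebra $\mathrm{End}_A$.
   Context: **Filtered $A_\infty$-algebras.** $\mathbb K$ is a field; $|a|$ is the degree of a homogeneous element and $\|a\|=|a|-1$. A discrete submonoid is an additive submonoid $G\subset\mathbb R_{\ge0}\times2\mathbb Z$, with projections $E:G\to\mathbb R_{\ge0}$, $\mu:G\to 2\mathbb Z$, such that $E^{-1}([0,c])$ is finite for all $c\ge0$. A ($G$-gapped) filtered $A_\infty$-algebra is a $\mathbb Z$-graded $\mathbb K$-vector space $A$ with multilinear maps $\mathfrak m_{k,\beta}:A^{\otimes k}\to A$ ($k\ge0,\beta\in G$) of degree $2-k-\mu(\beta)$, $\mathfrak m_{0,0}=0$, such that for all $n\ge 0$, $\beta\in G$, $a_i$ homogeneous, $$\sum_{\beta_1+\beta_2=\beta,\;0\le j\le n,\;1\le i\le n-j+1}(-1)^{\sum_{l<i}\|a_l\|}\mathfrak m_{n-j+1,\beta_2}(a_1,\dots,\mathfrak m_{j,\beta_1}(a_i,\dots,a_{i+j-1}),\dots,a_n)=0.$$ A unit is $e_A\in A$ of degree $0$ with $\mathfrak m_{2,0}(e_A,a)=(-1)^{|a|}\mathfrak m_{2,0}(a,e_A)=a$ and all other $\mathfrak m_{k,\beta}$ vanishing when some entry is $e_A$. A filtered dg-algebra is one with $\mathfrak m_{k,\beta}=0$ for $k>2$ and for $k=2,\beta\neq0$. **Homomorphisms.** $F:A\to B$ (both $G$-gapped) is a family $F_{k,\beta}:A^{\otimes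 k}\to B$ of degree $1-k-\mu(\beta)$, $F_{0,0}=0$, with, for all $n\ge0$ and $\beta$, $$\sum\mathfrak m^B_{l,\beta_0}(F_{k_1,\beta_1}(a_1,\dots),\dots,F_{k_l,\beta_l}(\dots,a_n))=\sum(-1)^{\sum_{l<i}\|a_l\|}F_{n-j+1,\beta_2}(a_1,\dots,\mathfrak m^A_{j,\beta_1}(a_i,\dots),\dots,a_n),$$ left sum over $l,k_i\ge0$, $\sum k_i=n$, $\beta_0+\dots+\beta_l=\beta$; right sum over $i,j$ and $\beta_1+\beta_2=\beta$. It is a quasi-isomorphism if $F_{1,0}$ induces an isomorphism on $\mathfrak m_{1,0}$-cohomology. **The dg-algebra $\mathrm{End}_A$** ($G$-gapped). As a vector space it is the subspace of $\mathrm{Hom}_{\mathbb K}(\bigoplus_{s\ge0}A\otimes A^{\otimes s},A)$ of $\rho=\{\rho_s\}$ with $\rho_s(v,a_1,\dots,a_s)=0$ if some $a_i=e_A$; $\rho$ has degree $|\rho|$ if each $\rho_s$ has degree $|\rho|-s$. Operations: $(\mu_{0,\beta})_s(v,a_1,\dots,a_s)=\sum_{\beta_1+\beta_2=\beta}\mathfrak m_{s+2,\beta_1}(\mathfrak m_{0,\beta_2},v,a_1,\dots,a_s)$; $$\begin{aligned}(\mu_{1,\beta}\rho)_s(v,a_1,\dots,a_s)=&-\sum_i\mathfrak m_{s-i+1,\beta}(\rho_i(v,a_1,\dots,a_i),\dots,a_s)+\sum_i(-1)^{|\rho|}\rho_{s-i}(\mathfrak m_{i+1,\beta}(v,a_1,\dots,a_i),\dots,a_s)\\&+\sum_{i,j\ge0}(-1)^{|\rho|+\|v\|+\sum_{l\le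 i}\|a_l\|}\rho_{s-j+1}(v,\dots,\mathfrak m_{j,\beta}(a_{i+1},\dots,a_{i+j}),\dots,a_s);\end{aligned}$$ $\mu_{2,0}(\rho,\tau)=(-1)^{|\rho|}\rho\circ\tau$ with $(\rho\circ\tau)_s(v,a_1,\dots,a_s)=\sum_i\rho_{s-i}(\tau_i(v,a_1,\dots,a_i),\dots,a_s)$; all other $\mu_{k,\beta}=0$. *)

(* Defs.v *)
From HB Require Import structures.
From mathcomp Require Import all_boot all_order all_algebra.
From mathcomp Require Import generic_quotient ring_quotient.
From mathcomp Require Import finmap boolp classical_sets functions cardinality.
From mathcomp Require Import fsbigop reals zify.

Set Implicit Arguments.
Unset Strict Implicit.
Unset Printing Implicit Defensive.
Import Order.TTheory GRing.Theory Num.Theory.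
Local Open Scope classical_set_scope.
Local Open Scope ring_scope.
Local Open Scope quotient_scope.

(* An element (x, k) of G has energy E = x and Maslov index mu = k.           *)
Record discreteSubmonoid (R : realType) := DiscreteSubmonoid {
  dsm_set :> set (R * int);
  dsm0 : dsm_set 0;
  dsmD : forall x y, dsm_set x -> dsm_set y -> dsm_set (x + y);
  dsm_ge0 : forall x, dsm_set x -> 0 <= x.1;
  dsm_even : forall x, dsm_set x -> (2 %| x.2)%Z;
  dsm_fin : forall c : R, 0 <= c ->
    finite_set [set x | dsm_set x /\ x.1 <= c] }.

Definition dzero (R : realType) (G : discreteSubmonoid R) : G :=
  exist _ 0 (mem_set (dsm0 G)).

Definition maslov (R : realType) (G : discreteSubmonoid R) (b : G) : int :=
  (val b).2.

Definition splits (R : realType) (G : discreteSubmonoid R) (b : G) :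
  set (G * G) := [set p | val p.1 + val p.2 = val b].

Lemma splits_finite (R : realType) (G : discreteSubmonoid R) (b : G) :
  finite_set (splits b).
Proof.
have bG : dsm_set G (val b) by exact: set_mem (valP b).
set S := [set x : R * int | dsm_set G x /\ x.1 <= (val b).1].
have Sfin : finite_set S by apply: dsm_fin; exact: (dsm_ge0 bG).
have Tfin : finite_set [set g : G | S (val g)].
  by apply: (finite_preimage _ Sfin) => x y _ _; exact: val_inj.
apply: (@sub_finite_set _ _ ([set g : G | S (val g)] `*` [set g : G | S (val g)])).
  move=> [x y] /= xy; have xG : dsm_set G (val x) by exact: set_mem (valP x).
  have yG : dsm_set G (val y) by exact: set_mem (valP y).
  split=> /=; split=> //; rewrite -xy /=.
    by rewrite lerDl (dsm_ge0 yG).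
  by rewrite lerDr (dsm_ge0 xG).
exact: finite_setX.
Qed.

(* A linear map on the k-fold tensor powers for all k at once: its component  *)
(* on the k-th tensor power is the restriction of f to sequences of size k.   *)
Definition multilinear (K : fieldType) (U V : lmodType K) (f : seq U -> V) :=
  forall s1 s2 c x y,
    f (s1 ++ (c *: x + y) :: s2) = c *: f (s1 ++ x :: s2) + f (s1 ++ y :: s2).

(* Internal direct sum decompositions indexed by the integers.                *)
Record gradedMod (K : fieldType) := GradedMod {
  gsort :> lmodType K;
  homog : int -> set gsort;
  homog0 : forall d, homog d 0;
  homogP : forall d c x y, homog d x -> homog d y -> homog d (c *: x + y);
  homog_decomp : forall x : gsort, exists! f : int -> gsort,
    [/\ forall d, homog d (f d), finite_set [set d | f d != 0]
      & x = \sum_(d \in [set: int]) f d] }.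
Arguments homog {K} _ _.

Fixpoint homogs (K : fieldType) (A : gradedMod K) (ds : seq int) (s : seq A) :
  Prop :=
  match ds, s with
  | [::], [::] => True
  | d :: ds', a :: s' => homog A d a /\ homogs ds' s'
  | _, _ => False
  end.

Section Grading.
Variables (K : fieldType) (A : gradedMod K).
Implicit Types (x y : A) (d : int).

Definition gcomp x : int -> A := projT1 (cid (homog_decomp x)).

(* The linear extension of a |-> (-1)^|a| a.                                  *)
Definition gsign x : A := \sum_(d \in [set: int]) (-1) ^ d *: gcomp x d.

(* The linear extension of a |-> (-1)^||a|| a, where ||a|| = |a| - 1.         *)
Definition ssign x : A := - gsign x.

Lemma fsum_lin (V : lmodType K) (f g : int -> V) c :
  finite_set [set d | f d != 0] -> finite_set [set d | g d != 0] ->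
  \sum_(d \in [set: int]) (c *: f d + g d) =
  c *: \sum_(d \in [set: int]) f d + \sum_(d \in [set: int]) g d.
Proof.
move=> ff fg.
pose X := fset_set ([set d | f d != 0] `|` [set d | g d != 0]).
have XP d : d \notin X -> f d = 0 /\ g d = 0.
  rewrite in_fset_set ?finite_setU// => /negP dX.
  by split; apply/eqP; apply: contra_notT dX => ?; apply/mem_set; [left|right].
rewrite (fsbigTE X) => [|d /XP[-> ->]]; last by rewrite scaler0 addr0.
rewrite (fsbigTE X f) => [|d /XP[]//]; rewrite (fsbigTE X g) => [|d /XP[]//].
by rewrite big_split /= scaler_sumr.
Qed.

Lemma gcompP x : [/\ forall d, homog A d (gcomp x d),
  finite_set [set d | gcomp x d != 0] & x = \sum_(d \in [set: int]) gcomp x d].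
Proof. by rewrite /gcomp; case: cid => /= f []. Qed.

Lemma gcomp_uniq x (f : int -> A) : (forall d, homog A d (f d)) ->
  finite_set [set d | f d != 0] -> x = \sum_(d \in [set: int]) f d ->
  gcomp x = f.
Proof. by move=> *; rewrite /gcomp; case: cid => /= g [_]; apply. Qed.

Lemma homog_scale d c x : homog A d x -> homog A d (c *: x).
Proof. by move=> hx; rewrite -[c *: x]addr0; apply: homogP => //; exact: homog0. Qed.

Lemma homogD d x y : homog A d x -> homog A d y -> homog A d (x + y).
Proof. by move=> hx hy; rewrite -[x]scale1r; exact: homogP. Qed.

Lemma homog_sum d (I : Type) (r : seq I) (P : pred I) (F : I -> A) :
  (forall i, P i -> homog A d (F i)) -> homog A d (\sum_(i <- r | P i) F i).
Proof.
by move=> hF; apply: big_ind => //; [exact: homog0|move=> *; exact: homogD].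
Qed.

Lemma gcomp_lin d c x y :
  gcomp (c *: x + y) d = c *: gcomp x d + gcomp y d.
Proof.
have [hx fx ex] := gcompP x; have [hy fy ey] := gcompP y.
suff -> : gcomp (c *: x + y) = fun d => c *: gcomp x d + gcomp y d by [].
apply: gcomp_uniq => [d'||].
- exact: homogP.
- apply: (@sub_finite_set _ _ ([set d | gcomp x d != 0] `|` [set d | gcomp y d != 0])).
    move=> d' /= nz; case: (eqVneq (gcomp x d') 0) => [x0|]; last by left.
    by right; move: nz; rewrite x0 scaler0 add0r.
  by rewrite finite_setU.
- by rewrite fsum_lin// -ex -ey.
Qed.

Lemma gcomp_homog d d' x : homog A d x ->
  gcomp x d' = if d' == d then x else 0.
Proof.
move=> hx; suff -> : gcomp x = fun d' => if d' == d then x else 0 by [].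
apply: gcomp_uniq => [d1||].
- by case: eqP => [->|_]//; exact: homog0.
- apply: (@sub_finite_set _ _ [set d]) => // d1 /=.
  by case: (d1 =P d) => // _; rewrite eqxx.
- rewrite (fsbigTE [fset d]%fset) => [|i]; last by rewrite inE => /negPf ->.
  by rewrite big_seq_fset1 eqxx.
Qed.

Lemma gcomp0 d : gcomp 0 d = 0.
Proof. by rewrite (@gcomp_homog 0) ?if_same//; exact: homog0. Qed.

Lemma gcomp_sum d (I : Type) (r : seq I) (F : I -> A) :
  gcomp (\sum_(i <- r) F i) d = \sum_(i <- r) gcomp (F i) d.
Proof.
elim: r => [|i r IH]; first by rewrite !big_nil gcomp0.
by rewrite !big_cons -IH -[F i in LHS]scale1r gcomp_lin scale1r.
Qed.

Lemma gsign_lin c x y : gsign (c *: x + y) = c *: gsign x + gsign y.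
Proof.
have [_ fx _] := gcompP x; have [_ fy _] := gcompP y.
have H z : finite_set [set d | gcomp z d != 0] ->
    finite_set [set d | (-1) ^ d *: gcomp z d != 0].
  apply: sub_finite_set => d /=; apply: contraNneq => ->.
  by rewrite scaler0.
rewrite /gsign -fsum_lin; [|exact: H|exact: H].
apply: eq_fsbigr => d _.
by rewrite gcomp_lin scalerDr !scalerA mulrC.
Qed.

Lemma gsignE d x : homog A d x -> gsign x = (-1) ^ d *: x.
Proof.
move=> hx; rewrite /gsign (fsbigTE [fset d]%fset) => [|i].
  by rewrite big_seq_fset1 (gcomp_homog _ hx) eqxx.
by rewrite inE => /negPf id; rewrite (gcomp_homog _ hx) id scaler0.
Qed.

Lemma ssign_lin c x y : ssign (c *: x + y) = c *: ssign x + ssign y.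
Proof. by rewrite /ssign gsign_lin opprD scalerN. Qed.

Lemma ssignE d x : homog A d x -> ssign x = (-1) ^ (d - 1) *: x.
Proof.
move=> hx; rewrite /ssign (gsignE hx) exprzDr ?unitrN ?unitr1//.
by rewrite -scaleNr exprN1 invrN1 mulrN1.
Qed.

Lemma ssign_homog d x : homog A d x -> homog A d (ssign x).
Proof. by move=> hx; rewrite (ssignE hx); exact: homog_scale. Qed.

Lemma homog_ind (P : A -> Prop) : P 0 ->
  (forall c x y, P x -> P y -> P (c *: x + y)) ->
  (forall d x, homog A d x -> P x) -> forall x, P x.
Proof.
move=> P0 PD Ph x; have [hx fx ->] := gcompP x.
rewrite (fsbigTE (fset_set [set d | gcomp x d != 0])) => [|d].
  apply: big_ind => // [y z Py Pz|d _]; last exact: Ph (hx d).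
  by rewrite -[y]scale1r; exact: PD.
rewrite in_fset_set// => dn; apply/eqP; apply: contraNT dn => ?.
exact/mem_set.
Qed.

Lemma homogs_size ds (s : seq A) : homogs ds s -> size ds = size s.
Proof. by elim: ds s => [|d ds IH] [|a s] //= [_ /IH ->]. Qed.

Lemma homogs_cat ds1 ds2 (s1 s2 : seq A) :
  homogs ds1 s1 -> homogs ds2 s2 -> homogs (ds1 ++ ds2) (s1 ++ s2).
Proof. by elim: ds1 s1 => [|d ds1 IH] [|a s1] //= [? ?] ?; split=> //; exact: IH. Qed.

Lemma homogs_take i ds (s : seq A) : homogs ds s -> homogs (take i ds) (take i s).
Proof. by elim: ds s i => [|d ds IH] [|a s] [|i] //= [? ?]; split=> //; exact: IH. Qed.

Lemma homogs_drop i ds (s : seq A) : homogs ds s -> homogs (drop i ds) (drop i s).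
Proof. by elim: ds s i => [|d ds IH] [|a s] [|i] //= [? ?]; exact: IH. Qed.

Lemma homogs_ssign ds (s : seq A) : homogs ds s -> homogs ds (map ssign s).
Proof.
by elim: ds s => [|d ds IH] [|a s] //= [? ?]; split; [exact: ssign_homog|exact: IH].
Qed.

Section Multilinear.
Variables (B : lmodType K) (f g : seq A -> B).
Hypotheses (fl : multilinear f) (gl : multilinear g).

Lemma multilin0 s1 s2 : f (s1 ++ 0 :: s2) = 0.
Proof.
by have := fl s1 s2 (-1) 0 0; rewrite scaler0 addr0 scaleN1r addNr.
Qed.

Lemma multilin0_in s : 0 \in s -> f s = 0.
Proof. by case/splitPr => s1 s2; exact: multilin0. Qed.

Lemma multilin_scale s1 s2 c x : f (s1 ++ c *: x :: s2) = c *: f (s1 ++ x :: s2).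
Proof. by rewrite -[c *: x]addr0 fl multilin0 addr0. Qed.

Lemma multilin_sgn s1 s2 ds (s : seq A) : homogs ds s ->
  f (s1 ++ map ssign s ++ s2) =
  (-1) ^ (\sum_(d <- ds) (d - 1)) *: f (s1 ++ s ++ s2).
Proof.
elim: ds s s1 => [|d ds IH] [|a s] s1 //=; first by rewrite big_nil scale1r.
move=> [ha hs]; rewrite big_cons (ssignE ha) multilin_scale -!(cat_rcons a) IH//.
by rewrite cat_rcons scalerA -exprzDr ?unitrN ?unitr1.
Qed.

Lemma multilin_ext : (forall ds s, homogs ds s -> f s = g s) -> f = g.
Proof.
move=> fg; apply/funext => s; rewrite -[s]cat0s.
have : homogs [::] ([::] : seq A) by [].
move: [::] [::] => s1 ds1; elim: s ds1 s1 => [|x s IH] ds1 s1 h1.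
  by rewrite cats0; exact: fg h1.
elim/homog_ind: x => [|c x y Hx Hy|d x hx].
- rewrite multilin0; symmetry.
  by have := gl s1 s (-1) 0 0; rewrite scaler0 addr0 scaleN1r addNr.
- by rewrite fl gl Hx Hy.
- rewrite -cat_rcons; apply: (IH (rcons ds1 d)).
  by rewrite -!cats1; apply: homogs_cat.
Qed.
End Multilinear.

End Grading.

Record ainftyData (R : realType) (G : discreteSubmonoid R) (K : fieldType) :=
  AinftyData {
    acarrier :> gradedMod K;
    aop : G -> seq acarrier -> acarrier;
    aop_multilinear : forall b, multilinear (aop b) }.
Arguments aop {R G K} _ _ _.

(* The sum over b1 + b2 = b and all i, j of                                   *)
(*   (-1)^(||a_1|| + ... + ||a_i||)                                           *)
(*     F_{b2}(a_1, .., a_i, m_{b1}(a_{i+1}, .., a_{i+j}), a_{i+j+1}, .., a_n) *)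
(* where s = (a_1, .., a_n) and ds = (|a_1|, .., |a_n|).                      *)
Definition bar_sum (R : realType) (G : discreteSubmonoid R) (K : fieldType)
    (A : ainftyData G K) (B : lmodType K) (F : G -> seq A -> B)
    (b : G) (ds : seq int) (s : seq A) : B :=
  \sum_(p \in splits b)
   \sum_(i < (size s).+1) \sum_(j < (size s).+1 | (i + j <= size s)%N)
     (-1) ^ (\sum_(d <- take i ds) (d - 1)) *:
       F p.2 (take i s ++ aop A p.1 (take j (drop i s)) :: drop (i + j) s).

Record is_filtered_ainfty (R : realType) (G : discreteSubmonoid R)
    (K : fieldType) (A : ainftyData G K) : Prop := IsFilteredAinfty {
  aop_degree : forall b ds (s : seq A), homogs ds s ->
    homog A (\sum_(d <- ds) d + 2 - (size s)%:Z - maslov b) (aop A b s);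
  aop00 : aop A (dzero G) [::] = 0;
  aop_rel : forall b ds (s : seq A), homogs ds s -> bar_sum (aop A) b ds s = 0 }.

Record is_filtered_dg (R : realType) (G : discreteSubmonoid R)
    (K : fieldType) (A : ainftyData G K) : Prop := IsFilteredDg {
  dg_ainfty : is_filtered_ainfty A;
  dg_high : forall b (s : seq A), (2 < size s)%N -> aop A b s = 0;
  dg_mul : forall b (s : seq A), size s = 2%N -> b <> dzero G -> aop A b s = 0 }.

Record is_unit (R : realType) (G : discreteSubmonoid R) (K : fieldType)
    (A : ainftyData G K) (e : A) : Prop := IsUnit {
  unit_degree : homog A 0 e;
  unit_mull : forall a, aop A (dzero G) [:: e; a] = a;
  unit_mulr : forall d a, homog A d a -> (-1) ^ d *: aop A (dzero G) [:: a; e] = a;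
  unit_other : forall b (s : seq A), e \in s ->
    ~ (b = dzero G /\ size s = 2%N) -> aop A b s = 0 }.

Record unitalAinfty (R : realType) (G : discreteSubmonoid R) (K : fieldType) :=
  UnitalAinfty {
    uadata :> ainftyData G K;
    ua_ainfty : is_filtered_ainfty uadata;
    uaone : uadata;
    ua_unit : is_unit uaone }.
Arguments uaone {R G K} _.

(* On the left-hand side of the relation, an index is a pair of b0 and a list *)
(* of pairs (b_i, block_i) such that b0 + b1 + .. + bl = b and the l (possibly *)
(* empty) consecutive blocks concatenate to (a_1, .., a_n). This index set is *)
(* infinite, but as F_{0,0} = 0 only finitely many of the terms are nonzero.  *)
Record ainftyHom (R : realType) (G : discreteSubmonoid R) (K : fieldType)
    (A B : ainftyData G K) := AinftyHom {
  hmap :> G -> seq A -> B;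
  hmap_multilinear : forall b, multilinear (hmap b);
  hmap_degree : forall b ds (s : seq A), homogs ds s ->
    homog B (\sum_(d <- ds) d + 1 - (size s)%:Z - maslov b) (hmap b s);
  hmap00 : hmap (dzero G) [::] = 0;
  hmap_rel : forall b ds (s : seq A), homogs ds s ->
    \sum_(q \in [set q : G * seq (G * seq A) |
        val q.1 + \sum_(p <- q.2) val p.1 = val b
        /\ flatten [seq p.2 | p <- q.2] = s])
      aop B q.1 [seq hmap p.1 p.2 | p <- q.2]
    = bar_sum hmap b ds s }.

Section Cohomology.
Variables (R : realType) (G : discreteSubmonoid R) (K : fieldType).
Variable A : ainftyData G K.

Definition adiff (a : A) : A := aop A (dzero G) [:: a].

Lemma adiff_lin c x y : adiff (c *: x + y) = c *: adiff x + adiff y.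
Proof. exact: (aop_multilinear (dzero G) [::] [::]). Qed.

Lemma adiff0 : adiff 0 = 0.
Proof. by have := adiff_lin (-1) 0 0; rewrite scaler0 addr0 scaleN1r addNr. Qed.

Definition cycle_pred : {pred A} := [pred a | adiff a == 0].

Fact cycle_submod_closed : submod_closed cycle_pred.
Proof.
split; first by rewrite inE adiff0.
by move=> c x y /eqP x0 /eqP y0; rewrite inE adiff_lin x0 y0 scaler0 addr0.
Qed.
HB.instance Definition _ :=
  GRing.isSubmodClosed.Build K A cycle_pred cycle_submod_closed.

Record cycles := Cycle { cycle_val :> A; _ : cycle_val \in cycle_pred }.
HB.instance Definition _ := [isSub for cycle_val].
HB.instance Definition _ := [Choice of cycles by <:].
HB.instance Definition _ := [SubChoice_isSubLmodule of cycles by <:].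

Definition boundary_pred : {pred cycles} :=
  [pred z | `[< exists b : A, val z = adiff b >]].

Fact boundary_zmod_closed : zmod_closed boundary_pred.
Proof.
split; first by apply/asboolP; exists 0; rewrite adiff0.
move=> x y /asboolP[b xb] /asboolP[c yc]; apply/asboolP; exists (b - c).
have -> : adiff (b - c) = adiff b - adiff c.
  by rewrite addrC -scaleN1r adiff_lin scaleN1r addrC.
by rewrite -xb -yc raddfB.
Qed.
HB.instance Definition _ :=
  GRing.isZmodClosed.Build cycles boundary_pred boundary_zmod_closed.

Lemma boundaryZ c z : z \in boundary_pred -> c *: z \in boundary_pred.
Proof.
move=> /asboolP[b zb]; apply/asboolP; exists (c *: b).
by rewrite -[c *: b]addr0 adiff_lin adiff0 addr0 -zb; exact: linearZ.
Qed.

Definition cohomology := {ideal_quot boundary_pred}.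
HB.instance Definition _ := GRing.Zmodule.on cohomology.
HB.instance Definition _ := EqQuotient.on cohomology.

Definition cohomology_scale (c : K) (x : cohomology) : cohomology :=
  \pi_cohomology (c *: repr x).

Lemma cohomology_scaleE c z :
  cohomology_scale c (\pi_cohomology z) = \pi_cohomology (c *: z).
Proof.
apply/eqP; rewrite /cohomology_scale -Quotient.idealrBE -scalerBr.
have : \pi_cohomology (repr (\pi_cohomology z)) == \pi_cohomology z.
  by rewrite reprK.
rewrite -Quotient.idealrBE; exact: boundaryZ.
Qed.

Lemma cohomologyP (x : cohomology) : exists z : cycles, x = \pi_cohomology z.
Proof. by exists (repr x); rewrite reprK. Qed.

Lemma cohomologyD (z w : cycles) :
  \pi_cohomology (z + w) = \pi_cohomology z + \pi_cohomology w.
Proof. exact: Quotient.pi_add. Qed.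

Lemma cohomology_scaleA a b x :
  cohomology_scale a (cohomology_scale b x) = cohomology_scale (a * b) x.
Proof.
have [z ->] := cohomologyP x; rewrite !cohomology_scaleE.
by congr \pi_cohomology; exact: scalerA.
Qed.

Lemma cohomology_scale1 : left_id 1 cohomology_scale.
Proof.
move=> x; have [z ->] := cohomologyP x; rewrite cohomology_scaleE.
by congr \pi_cohomology; exact: scale1r.
Qed.

Lemma cohomology_scaleDr : right_distributive cohomology_scale +%R.
Proof.
move=> c x y; have [z ->] := cohomologyP x; have [w ->] := cohomologyP y.
rewrite -cohomologyD !cohomology_scaleE -cohomologyD.
by congr \pi_cohomology; exact: scalerDr.
Qed.

Lemma cohomology_scaleDl x : {morph cohomology_scale^~ x : a b / a + b}.
Proof.
move=> a b /=; have [z ->] := cohomologyP x.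
rewrite !cohomology_scaleE -cohomologyD.
by congr \pi_cohomology; exact: scalerDl.
Qed.

HB.instance Definition _ := GRing.Zmodule_isLmodule.Build K cohomology
  cohomology_scaleA cohomology_scale1 cohomology_scaleDr cohomology_scaleDl.
End Cohomology.

Section QuasiIsomorphism.
Variables (R : realType) (G : discreteSubmonoid R) (K : fieldType).
Implicit Types A B : ainftyData G K.

Definition induces_in_cohomology A B (F : ainftyHom A B)
    (phi : cohomology A -> cohomology B) :=
  forall z : cycles A, exists2 w : cycles B,
    val w = F (dzero G) [:: val z]
    & phi (\pi_(cohomology A) z) = \pi_(cohomology B) w.

Definition is_quasi_iso A B (F : ainftyHom A B) :=
  exists2 phi : {linear cohomology A -> cohomology B},
    induces_in_cohomology F phi & bijective phi.

Definition quasi_isomorphic A B := exists F : ainftyHom A B, is_quasi_iso F.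

End QuasiIsomorphism.

Section EndA.
Variables (R : realType) (G : discreteSubmonoid R) (K : fieldType).
Variable A : unitalAinfty G K.
Local Notation e := (uaone A).
Local Notation m := (aop A).

(* A family rho = (rho_s) is encoded as rho v [:: a_1; ..; a_s] =             *)
(* rho_s(v, a_1, .., a_s).                                                    *)
Local Notation family := (A -> seq A -> A).

Record end_homog (d : int) (rho : family) : Prop := EndHomog {
  eh_linl : forall s c x y, rho (c *: x + y) s = c *: rho x s + rho y s;
  eh_linr : forall v, multilinear (rho v);
  eh_red : forall v s, e \in s -> rho v s = 0;
  eh_deg : forall dv ds v s, homog A dv v -> homogs ds s ->
    homog A (dv + \sum_(d' <- ds) d' + d - (size s)%:Z) (rho v s) }.

(* The graded Hom space: End_A has to be the direct sum of its homogeneous    *)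
(* parts, so its elements are the finite sums of homogeneous families.        *)
Definition end_pred : {pred family} := fun rho =>
  `[< exists f : int -> family, [/\ forall d, end_homog d (f d),
      finite_set [set d | f d != 0] & rho = \sum_(d \in [set: int]) f d] >].

Definition end_mu0 (b : G) : family := fun v s =>
  \sum_(p \in splits b) m p.1 (m p.2 [::] :: v :: s).

(* rho' stands for (-1)^|rho| rho, and ssign puts the sign (-1)^||a|| on each *)
(* entry a; see endo_mu1E for the formula on homogeneous elements.            *)
Definition end_mu1 (b : G) (rho rho' : family) : family := fun v s =>
  - (\sum_(i < (size s).+1) m b (rho v (take i s) :: drop i s))
  + \sum_(i < (size s).+1) rho' (m b (v :: take i s)) (drop i s)
  + \sum_(i < (size s).+1) \sum_(j < (size s).+1 | (i + j <= size s)%N)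
      rho' (ssign v) (map (@ssign K A) (take i s) ++
                      m b (take j (drop i s)) :: drop (i + j) s).

Definition end_comp (rho tau : family) : family := fun v s =>
  \sum_(i < (size s).+1) rho (tau v (take i s)) (drop i s).

Lemma end_homog_lin d c rho tau : end_homog d rho -> end_homog d tau ->
  end_homog d (c *: rho + tau).
Proof.
move=> [l1 r1 e1 d1] [l2 r2 e2 d2]; split=> /=.
- move=> s k x y; rewrite !(addrfctE, scalrfctE) l1 l2.
  by rewrite !scalerDr !scalerA [c * k]mulrC addrACA.
- move=> v s1 s2 k x y; rewrite !(addrfctE, scalrfctE) r1 r2.
  by rewrite !scalerDr !scalerA [c * k]mulrC addrACA.
- by move=> v s es; rewrite !(addrfctE, scalrfctE) e1// e2// scaler0 addr0.
- by move=> dv ds v s hv hs; apply: homogP; [exact: d1|exact: d2].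
Qed.

Lemma end_homog0 d : end_homog d 0.
Proof.
split=> //=.
- by move=> s c x y; rewrite scaler0 addr0.
- by move=> v s1 s2 c x y; rewrite scaler0 addr0.
- by move=> *; exact: homog0.
Qed.

Lemma end_homog_pred d rho : end_homog d rho -> rho \in end_pred.
Proof.
move=> h; apply/asboolP; exists (fun d' => if d' == d then rho else 0).
split=> [d'||].
- by case: eqP => [->|_] //; exact: end_homog0.
- apply: (@sub_finite_set _ _ [set d]) => // d1 /=.
  by case: (d1 =P d) => // _; rewrite eqxx.
- rewrite (fsbigTE [fset d]%fset) => [|i]; last by rewrite inE => /negPf ->.
  by rewrite big_seq_fset1 eqxx.
Qed.

Fact end_submod_closed : submod_closed end_pred.
Proof.
split; first exact: (end_homog_pred (end_homog0 0)).
move=> c x y /asboolP[f [hf ff ->]] /asboolP[g [hg fg ->]]; apply/asboolP.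
exists (fun d => c *: f d + g d); split=> [d||].
- exact: end_homog_lin.
- apply: (@sub_finite_set _ _ ([set d | f d != 0] `|` [set d | g d != 0])).
    move=> d' /= nz; case: (eqVneq (f d') 0) => [x0|]; last by left.
    by right; move: nz; rewrite x0 scaler0 add0r.
  by rewrite finite_setU.
- exact: esym (@fsum_lin K family f g c ff fg).
Qed.
HB.instance Definition _ :=
  GRing.isSubmodClosed.Build K family end_pred end_submod_closed.

Record endo := Endo { endo_val :> family; _ : endo_val \in end_pred }.
HB.instance Definition _ := [isSub for endo_val].
HB.instance Definition _ := [Choice of endo by <:].
HB.instance Definition _ := [SubChoice_isSubLmodule of endo by <:].

Lemma endo_valD (x y : endo) : val (x + y) = val x + val y.
Proof. exact: raddfD. Qed.

Lemma endo_valZ c (x : endo) : val (c *: x) = c *: val x.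
Proof. exact: linearZ. Qed.

Lemma endo_valP c (x y : endo) : val (c *: x + y) = c *: val x + val y.
Proof. by rewrite endo_valD endo_valZ. Qed.

Lemma endo_val_sum (I : Type) (r : seq I) (F : I -> endo) :
  val (\sum_(i <- r) F i) = \sum_(i <- r) val (F i).
Proof. exact: raddf_sum. Qed.

Definition endo_homog (d : int) : set endo := [set rho | end_homog d (val rho)].

Lemma family_ext (rho tau : family) :
  (forall s c x y, rho (c *: x + y) s = c *: rho x s + rho y s) ->
  (forall s c x y, tau (c *: x + y) s = c *: tau x s + tau y s) ->
  (forall v, multilinear (rho v)) -> (forall v, multilinear (tau v)) ->
  (forall dv ds v s, homog A dv v -> homogs ds s -> rho v s = tau v s) ->
  rho = tau.
Proof.
move=> l1 l2 r1 r2 H; apply/funext => v.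
elim/homog_ind: v => [|c x y Hx Hy|dv v hv].
- apply/funext => s; have := l1 s (-1) 0 0; have := l2 s (-1) 0 0.
  by rewrite !scaler0 !addr0 !scaleN1r !addNr => -> ->.
- by apply/funext => s; rewrite l1 l2 Hx Hy.
- by apply: multilin_ext => // ds s; exact: (H dv).
Qed.

Lemma end_decomp_comp (f : int -> endo) (rho : endo) dv ds v s d :
  (forall d, endo_homog d (f d)) -> finite_set [set d | f d != 0] ->
  rho = \sum_(d \in [set: int]) f d -> homog A dv v -> homogs ds s ->
  val (f d) v s =
  gcomp (val rho v s) (dv + \sum_(d' <- ds) d' + d - (size s)%:Z).
Proof.
move=> hf ff -> hv hs; pose X := fset_set [set d | f d != 0].
have XP d' : d' \notin X -> f d' = 0.
  rewrite in_fset_set// => /negP dX; apply/eqP; apply: contra_notT dX => ?.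
  exact/mem_set.
rewrite (fsbigTE X)// endo_val_sum !fct_sumE gcomp_sum.
have E d' : gcomp (val (f d') v s)
    (dv + \sum_(d' <- ds) d' + d - (size s)%:Z) =
    if d' == d then val (f d) v s else 0.
  rewrite (gcomp_homog _ (eh_deg (hf d') hv hs)).
  have -> : (dv + \sum_(d' <- ds) d' + d - (size s)%:Z ==
     dv + \sum_(d' <- ds) d' + d' - (size s)%:Z) = (d' == d) by lia.
  by case: eqP => // ->.
under eq_bigr do rewrite E.
rewrite -big_mkcond /=; have [dX|dX] := boolP (d \in X).
  by rewrite -big_filter filter_pred1_uniq ?fset_uniq// big_seq1.
rewrite big1_seq => [|d' /andP[/eqP -> dX']]; last by rewrite dX' in dX.
by rewrite XP.
Qed.

Lemma endo_decomp (rho : endo) : exists! f : int -> endo,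
  [/\ forall d, endo_homog d (f d), finite_set [set d | f d != 0]
    & rho = \sum_(d \in [set: int]) f d].
Proof.
have /asboolP[f [hf ff ef]] := valP rho.
pose g d : endo := Endo (end_homog_pred (hf d)).
have gE d : (g d != 0) = (f d != 0) by rewrite -(inj_eq val_inj).
have hg d : endo_homog d (g d) by exact: hf.
have fg : finite_set [set d | g d != 0].
  by apply: sub_finite_set ff => d /=; rewrite gE.
have eg : rho = \sum_(d \in [set: int]) g d.
  have XP d : d \notin fset_set [set d | f d != 0] -> f d = 0.
    rewrite in_fset_set// => /negP dX; apply/eqP; apply: contra_notT dX => ?.
    exact/mem_set.
  apply: val_inj; rewrite (fsbigTE (fset_set [set d | f d != 0])).
    by rewrite endo_val_sum -[RHS](fsbigTE _ _ XP).
  by move=> d /XP fd; apply: val_inj.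
exists g; split=> // h [hh fh eh]; apply/funext => d; apply: val_inj.
have [l1 r1 _ _] := hg d; have [l2 r2 _ _] := hh d.
apply: family_ext => // dv ds v s hv hs.
by rewrite (end_decomp_comp d hg fg eg hv hs) (end_decomp_comp d hh fh eh hv hs).
Qed.

Lemma endo_homog0 d : endo_homog d 0.
Proof. exact: end_homog0. Qed.

Lemma endo_homogP d c x y :
  endo_homog d x -> endo_homog d y -> endo_homog d (c *: x + y).
Proof. by move=> hx hy; have := end_homog_lin c hx hy; rewrite -endo_valP. Qed.

Definition end_graded : gradedMod K :=
  GradedMod endo_homog0 endo_homogP endo_decomp.

Lemma split_seq (T : Type) (s1 s2 : seq T) i :
  (forall x, take i (s1 ++ x :: s2) = take i s1) /\
  (forall x, drop i (s1 ++ x :: s2) = drop i s1 ++ x :: s2)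
  \/
  (forall x, take i (s1 ++ x :: s2) = s1 ++ x :: take (i - (size s1).+1) s2) /\
  (forall x, drop i (s1 ++ x :: s2) = drop (i - (size s1).+1) s2).
Proof.
have [|lti] := leqP i (size s1).
  rewrite leq_eqVlt => /orP[/eqP ->|lti]; left; split=> x.
  - by rewrite take_size_cat// take_size.
  - by rewrite drop_size_cat// drop_size.
  - by rewrite take_cat lti.
  - by rewrite drop_cat lti.
right; have E : (i - size s1 = (i - (size s1).+1).+1)%N by lia.
by split=> x; rewrite ?take_cat ?drop_cat ltnNge ltnW//= E.
Qed.

Lemma homog_eqd (V : gradedMod K) d d' (x : V) :
  d = d' -> homog V d x -> homog V d' x.
Proof. by move=> ->. Qed.

Lemma sum_take_drop i (ds : seq int) : \sum_(d <- ds) d =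
  \sum_(d <- take i ds) d + \sum_(d <- drop i ds) d.
Proof. by rewrite -big_cat cat_take_drop. Qed.

Lemma fam0l (rho : family) s :
  (forall c x y, rho (c *: x + y) s = c *: rho x s + rho y s) -> rho 0 s = 0.
Proof.
by move=> H; have := H (-1) 0 0; rewrite scaler0 addr0 scaleN1r addNr.
Qed.

Lemma end_comp_homog d1 d2 rho tau : end_homog d1 rho -> end_homog d2 tau ->
  end_homog (d1 + d2) (end_comp rho tau).
Proof.
move=> [l1 r1 e1 h1] [l2 r2 e2 h2]; split.
- move=> s c x y; rewrite /end_comp scaler_sumr -big_split.
  by apply: eq_bigr => i _; rewrite l2 l1.
- move=> v s1 s2 c x y; rewrite /end_comp !size_cat /= scaler_sumr -big_split.
  apply: eq_bigr => i _; case: (split_seq s1 s2 i) => -[Ht Hd];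
    rewrite !Ht !Hd /=; first by rewrite r1.
  by rewrite r2 l1.
- move=> v s es; rewrite /end_comp big1// => i _.
  have : e \in take i s ++ drop i s by rewrite cat_take_drop.
  rewrite mem_cat => /orP[et|ed]; last exact: e1.
  by rewrite e2//; exact: fam0l.
- move=> dv ds v s hv hs; apply: homog_sum => i _.
  have hi := h2 _ _ _ _ hv (homogs_take i hs).
  apply: homog_eqd (h1 _ _ _ _ hi (homogs_drop i hs)).
  have li : (i <= size s)%N by rewrite -ltnS.
  by rewrite (size_takel li) size_drop (sum_take_drop i ds); lia.
Qed.

Lemma end_mu0_homog b : end_homog (2 - maslov b) (end_mu0 b).
Proof.
have fb : finite_set (splits b) := splits_finite b.
split.
- move=> s c x y; rewrite /end_mu0 !fsbig_finite// scaler_sumr -big_split /=.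
  apply: eq_bigr => p _.
  exact: (aop_multilinear p.1 [:: m p.2 [::]] s).
- move=> v s1 s2 c x y; rewrite /end_mu0 !fsbig_finite// scaler_sumr -big_split.
  apply: eq_bigr => p _.
  exact: (aop_multilinear p.1 (m p.2 [::] :: v :: s1) s2).
- move=> v s es; rewrite /end_mu0 fsbig1// => p _.
  rewrite (unit_other (ua_unit A))//; first by rewrite !inE es !orbT.
  by case=> _; case: (s) es.
- move=> dv ds v s hv hs; rewrite /end_mu0 fsbig_finite//.
  rewrite [X in homog _ _ X]big_seq; apply: homog_sum => p.
  rewrite in_fset_set// => /set_mem pb.
  have h0 := @aop_degree _ _ _ _ (ua_ainfty A) p.2 [::] [::] I.
  have hh := @aop_degree _ _ _ _ (ua_ainfty A) p.1
    [:: _, dv & ds] [:: _, v & s] (conj h0 (conj hv hs)).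
  apply: homog_eqd hh; rewrite !big_cons big_nil /=.
  have : maslov p.1 + maslov p.2 = maslov b by rewrite /maslov -pb.
  move=> <-; move: (maslov p.1) (maslov p.2) => x y. lia.
Qed.

Lemma three_sum (V : lmodType K) c (x x1 x2 y y1 y2 z z1 z2 : V) :
  x = c *: x1 + x2 -> y = c *: y1 + y2 -> z = c *: z1 + z2 ->
  - x + y + z = c *: (- x1 + y1 + z1) + (- x2 + y2 + z2).
Proof.
move=> -> -> ->; rewrite opprD !scalerDr scalerN.
by rewrite [X in X + _ = _]addrACA [LHS]addrACA.
Qed.

Lemma end_mu1_lin b c (r1 r2 r1' r2' : family) :
  end_mu1 b (c *: r1 + r2) (c *: r1' + r2') =
  c *: end_mu1 b r1 r1' + end_mu1 b r2 r2'.
Proof.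
apply/funext => v; apply/funext => s.
apply: three_sum; rewrite scaler_sumr -big_split; apply: eq_bigr => i _ //.
  exact: (aop_multilinear b [::]).
by rewrite scaler_sumr -big_split.
Qed.

Lemma unit_gsign a : m (dzero G) [:: a; e] = gsign a.
Proof.
elim/homog_ind: a => [|c x y Hx Hy|d a ha].
- rewrite (multilin0 (aop_multilinear _) [::]).
  by rewrite (gsignE (homog0 A 0)) scaler0.
- by rewrite (aop_multilinear _ [::]) Hx Hy gsign_lin.
- rewrite (gsignE ha) -[in RHS](unit_mulr (ua_unit A) ha) scalerA.
  by rewrite -exprzMl ?unitrN1// mulrNN mulr1 exp1rz scale1r.
Qed.

Lemma ssign_unit : ssign e = - e.
Proof. by rewrite (ssignE (unit_degree (ua_unit A))) sub0r exprN1 invrN1 scaleN1r. Qed.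

Lemma sum_only (V : nmodType) (n k : nat) (F : nat -> V) :
  (forall i, (i < n)%N -> i != k -> F i = 0) ->
  \sum_(i < n) F i = if (k < n)%N then F k else 0.
Proof.
move=> H; rewrite (eq_bigr (fun i : 'I_n => if i == k :> nat then F i else 0)).
  by rewrite -big_mkcond; exact: big_ord1_eq.
by move=> i _; case: eqP => // /eqP; apply: H.
Qed.

Lemma signD (x y : int) : (-1 : K) ^ x * (-1) ^ y = (-1) ^ (x + y).
Proof. by rewrite exprzDr ?unitrN1. Qed.

Lemma signN (x : int) : - (-1 : K) ^ x = (-1) ^ (x + 1).
Proof. by rewrite -signD expr1z mulrN1. Qed.

Section Mu1.
Variables (d : int) (rho : family) (hrho : end_homog d rho) (b : G).
Let rho' : family := (-1) ^ d *: rho.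

Let hrho' : end_homog d rho'.
Proof.
by rewrite -[rho']addr0; apply: end_homog_lin => //; exact: end_homog0.
Qed.

Let b0 : K := (b == dzero G)%:R.

Lemma gsign_family v s :
  gsign (rho v s) = - rho' (ssign v) (map (@ssign K A) s).
Proof.
have [l1 r1 _ h1] := hrho; have [l2 r2 _ h2] := hrho'.
pose f1 : family := fun v s => gsign (rho v s).
pose f2 : family := fun v s => - rho' (ssign v) (map (@ssign K A) s).
suff E : f1 = f2 by have := congr1 (fun f : family => f v s) E.
apply: family_ext.
- by move=> s' c x y; rewrite /f1 l1 gsign_lin.
- by move=> s' c x y; rewrite /f2 ssign_lin l2 opprD scalerN.
- by move=> v' s1 s2 c x y; rewrite /f1 r1 gsign_lin.
- move=> v' s1 s2 c x y; rewrite /f2 !map_cat /= ssign_lin r2.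
  by rewrite opprD scalerN.
- move=> dv ds v' s' hv hs; rewrite /f1 /f2 (gsignE (h1 _ _ _ _ hv hs)).
  have := multilin_sgn (r2 (ssign v')) [::] [::] hs.
  rewrite !cats0 /= => ->; rewrite (ssignE hv).
  rewrite -[_ *: v']addr0 l2 (fam0l (l2 s')) addr0.
  rewrite /rho' scalrfctE /= scalrfctE !scalerA -scaleNr; congr (_ *: _).
  rewrite !signD signN.
  have -> : \sum_(d0 <- ds) (d0 - 1) = \sum_(d0 <- ds) d0 - (size s')%:Z.
    rewrite -(homogs_size hs) big_split /=; congr (_ + _).
    by elim: (ds) => [|? ? IH]; rewrite ?big_nil ?big_cons ?IH//=; lia.
  by congr (_ ^ _); move: (\sum_(d' <- ds) d') => S; lia.
Qed.

Lemma aop_eR a : m b [:: a; e] = b0 *: gsign a.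
Proof.
rewrite /b0; case: eqP => [->|bn]; first by rewrite unit_gsign scale1r.
by rewrite scale0r (unit_other (ua_unit A)) ?inE ?eqxx ?orbT// => -[].
Qed.

Lemma aop_eL a : m b [:: e; a] = b0 *: a.
Proof.
rewrite /b0; case: eqP => [->|bn].
  by rewrite (unit_mull (ua_unit A)) scale1r.
by rewrite scale0r (unit_other (ua_unit A)) ?inE ?eqxx// => -[].
Qed.

Lemma aop_e0 s : e \in s -> size s != 2%N -> m b s = 0.
Proof.
by move=> es /eqP s2; rewrite (unit_other (ua_unit A))// => -[].
Qed.

Section Reduced.
Variables (v : A) (s1 s2 : seq A).
Let s := s1 ++ e :: s2.
Let p := size s1.
Let n := size s.
Let X := rho' (ssign v) (map (@ssign K A) s1 ++ s2).

Let nE : n = (p + (size s2).+1)%N. Proof. by rewrite /n /s size_cat. Qed.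

Let take_e i : (p < i)%N -> e \in take i s.
Proof.
move=> pi; rewrite /s take_cat ltnNge ltnW//=.
have -> : (i - size s1 = (i - p.+1).+1)%N by rewrite -/p; lia.
by rewrite mem_cat /= inE eqxx orbT.
Qed.

Let drop_e i : (i <= p)%N -> e \in drop i s.
Proof.
rewrite leq_eqVlt => /orP[/eqP ->|ip]; first by rewrite drop_size_cat// inE eqxx.
by rewrite /s drop_cat ip mem_cat inE eqxx orbT.
Qed.

Let block_e i j : (i <= p)%N -> (p < i + j)%N -> e \in take j (drop i s).
Proof.
move=> ip pij; rewrite take_drop.
suff : e \in drop i (take (j + i) s) by [].
have le1 : (size s1 <= j + i)%N by rewrite -/p; lia.
  have E : (j + i - size s1 = (j + i - (size s1).+1).+1)%N by rewrite -/p; lia.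
  rewrite /s take_cat ltnNge le1 E.
  rewrite /= drop_cat; case: ltnP => ltp; first by rewrite mem_cat inE eqxx orbT.
  have -> : (i - size s1 = 0)%N by rewrite -/p; lia.
  by rewrite drop0 inE eqxx.
Qed.

Lemma mu1_sum1 : \sum_(i < n.+1) m b (rho v (take i s) :: drop i s) =
  if s2 is [::] then - (b0 *: X) else 0.
Proof.
have [l1 r1 e1 _] := hrho.
rewrite (sum_only (k := p) (F := fun i => m b (rho v (take i s) :: drop i s))).
  rewrite ltnS nE leq_addr take_size_cat// drop_size_cat//.
  rewrite /X; case: s2 => [|y t].
    by rewrite cats0 aop_eR gsign_family scalerN.
  by rewrite aop_e0 ?inE ?eqxx ?orbT.
move=> i; rewrite ltnS => lin ip; case: (ltngtP i p) ip => // ip _.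
  rewrite aop_e0 ?inE ?drop_e ?orbT ?(ltnW ip)//= size_drop -/n nE.
  by apply/eqP; lia.
by rewrite e1 ?take_e// (multilin0 (aop_multilinear b) [::]).
Qed.

Lemma mu1_sum2 : \sum_(i < n.+1) rho' (m b (v :: take i s)) (drop i s) =
  if s1 is [::] then - (b0 *: X) else 0.
Proof.
have [l1 r1 e1 _] := hrho'.
rewrite (sum_only (k := p.+1)
  (F := fun i => rho' (m b (v :: take i s)) (drop i s))).
  have sE : s = rcons s1 e ++ s2 by rewrite cat_rcons.
  rewrite ltnS nE addnS ltnS leq_addr sE.
  rewrite take_size_cat ?size_rcons// drop_size_cat ?size_rcons//.
  rewrite /X; case: (s1) => [|y t] /=; last first.
    by rewrite aop_e0 ?fam0l//= ?inE ?mem_rcons ?inE ?eqxx ?orbT// size_rcons.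
  rewrite aop_eR /ssign -[b0 *: gsign v]addr0 l1 fam0l// addr0.
  have := l1 s2 (-1) (gsign v) 0; rewrite (fam0l (l1 s2)) !addr0 scaleN1r => ->.
  by rewrite scaleN1r scalerN opprK.
move=> i; rewrite ltnS => lin ip; case: (leqP i p) => ip'.
  by rewrite e1// drop_e.
rewrite aop_e0 ?fam0l// ?inE ?take_e ?orbT//= size_takel//.
by apply/eqP; move/eqP: ip; lia.
Qed.

Let T (i j : nat) := rho' (ssign v) (map (@ssign K A) (take i s) ++
  m b (take j (drop i s)) :: drop (i + j) s).

Let inner i : \sum_(j < n.+1 | (i + j <= n)%N) T i j =
  if [&& (p < i + 2)%N, (i <= p)%N & (i + 2 <= n)%N] then T i 2 else 0.
Proof.
have [l1 r1 e1 _] := hrho'.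
have [pi|ip] := ltnP p i.
  rewrite andbF big1// => j _; rewrite /T.
  have := take_e pi; case/splitPr => t1 t2.
  rewrite map_cat /= ssign_unit -scaleN1r -catA /= (multilin_scale (r1 _)).
  by rewrite e1 ?scaler0// mem_cat inE eqxx orbT.
rewrite big_mkcond (sum_only (k := 2)
  (F := fun j => if (i + j <= n)%N then T i j else 0)) /=; last first.
  move=> j jn j2; case: ifP => // ijn; rewrite /T.
  have [ijp|pij] := leqP (i + j) p.
    by rewrite e1// mem_cat inE drop_e ?orbT.
  rewrite aop_e0 ?block_e//; first exact: (multilin0 (r1 _)).
  by rewrite size_takel ?size_drop// -/n; lia.
have -> : (if (2 < n.+1)%N then if (i + 2 <= n)%N then T i 2 else 0 else 0)
  = if (i + 2 <= n)%N then T i 2 else 0.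
  by case: ltnP => // n2; case: ifP => // i2; exfalso; lia.
case: ltnP => //= pi2; case: ifP => // _.
by rewrite /T e1// mem_cat inE drop_e ?orbT.
Qed.

Let T_p : (p + 2 <= n)%N -> T p 2 = b0 *: X.
Proof.
have [l1 r1 e1 _] := hrho'.
rewrite nE leq_add2l ltnS /T -addnC -drop_drop /X.
rewrite take_size_cat// drop_size_cat//; case: (s2) => [//|y t] _.
by rewrite /= take0 drop0 aop_eL (multilin_scale (r1 _)).
Qed.

Let T_p1 : (0 < p)%N -> T p.-1 2 = - (b0 *: X).
Proof.
have [l1 r1 e1 _] := hrho'.
rewrite /T /X /p /s; case/lastP: (s1) => // t x _.
rewrite size_rcons /= addnC -drop_drop cat_rcons.
rewrite take_size_cat// drop_size_cat// /= take0 drop0 aop_eR.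
rewrite (multilin_scale (r1 _)) map_rcons cat_rcons /ssign -[- gsign x]scaleN1r.
by rewrite (multilin_scale (r1 _)) scaleN1r scalerN opprK.
Qed.

Lemma mu1_sum3 : \sum_(i < n.+1) \sum_(j < n.+1 | (i + j <= n)%N)
    rho' (ssign v) (map (@ssign K A) (take i s) ++
      m b (take j (drop i s)) :: drop (i + j) s) =
  (if s2 is [::] then 0 else b0 *: X) + (if s1 is [::] then 0 else - (b0 *: X)).
Proof.
pose F1 : A := if s2 is [::] then 0 else b0 *: X.
pose F2 : A := if s1 is [::] then 0 else - (b0 *: X).
rewrite (eq_bigr (fun i : 'I_n.+1 => (if i == p :> nat then F1 else 0) +
  (if i == p.-1 :> nat then F2 else 0))).
  rewrite big_split /= -!big_mkcond /=.
  rewrite (big_ord1_eq _ (fun=> F1)) (big_ord1_eq _ (fun=> F2)).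
  have -> : (p < n.+1)%N by rewrite nE; lia.
  by have -> : (p.-1 < n.+1)%N by rewrite nE; lia.
move=> i _; rewrite -/(T _ _) inner.
have s20 : F1 = if (p + 2 <= n)%N then T p 2 else 0.
  have := T_p; rewrite nE leq_add2l ltnS /F1.
  by case: (s2) => [|y t] // ->.
have s10 : F2 = if (0 < p)%N then T p.-1 2 else 0.
  by have := T_p1; rewrite /F2 /p; case: (s1) => [|y t] // ->.
have [ip|ip] := eqVneq (i : nat) p.
  rewrite ip leqnn addn2 leqnSn /= -addn2 s20; case: eqP => [p0|]; last first.
    by rewrite addr0.
  by rewrite s10; case: (p) p0 => [|q]; [rewrite addr0|lia].
have [ip1|ip1] := eqVneq (i : nat) p.-1.
  have p0 : (0 < p)%N by move: ip; rewrite ip1; case: (p).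
  rewrite add0r s10 p0 ip1; case: ifP => // /negP[].
  by rewrite nE; lia.
rewrite addr0; case: ifP => // /and3P[? ? _]; exfalso.
by move: ip ip1 => /eqP ? /eqP ?; lia.
Qed.

Lemma mu1_reduced : end_mu1 b rho rho' v s = 0.
Proof.
rewrite /end_mu1 -/n mu1_sum1 mu1_sum2 mu1_sum3.
by case: s1 s2 => [|? ?] [|? ?];
  rewrite ?opprK ?oppr0 ?add0r ?addr0 ?addrN ?addNr ?subrr.
Qed.
End Reduced.

Lemma end_mu1_homog : end_homog (d + (1 - maslov b)) (end_mu1 b rho rho').
Proof.
have [l1 r1 e1 h1] := hrho; have [l2 r2 e2 h2] := hrho'.
have ml : multilinear (m b) := aop_multilinear b; have md := @aop_degree _ _ _ _ (ua_ainfty A) b.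
split.
- move=> s c x y; apply: three_sum; rewrite scaler_sumr -big_split;
    apply: eq_bigr => i _.
  + by rewrite l1 (ml [::]).
  + by rewrite (ml [::]) l2.
  + rewrite scaler_sumr -big_split; apply: eq_bigr => j _.
    by rewrite ssign_lin l2.
- move=> v s1 s2 c x y; rewrite /end_mu1 !size_cat /=.
  have E1 i : m b (rho v (take i (s1 ++ (c *: x + y) :: s2)) ::
        drop i (s1 ++ (c *: x + y) :: s2)) =
      c *: m b (rho v (take i (s1 ++ x :: s2)) :: drop i (s1 ++ x :: s2)) +
      m b (rho v (take i (s1 ++ y :: s2)) :: drop i (s1 ++ y :: s2)).
    case: (split_seq s1 s2 i) => -[Ht Hd]; rewrite !Ht !Hd.
      exact: (ml (rho v (take i s1) :: drop i s1)).
    by rewrite r1 (ml [::]).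
  have E2 i : rho' (m b (v :: take i (s1 ++ (c *: x + y) :: s2)))
        (drop i (s1 ++ (c *: x + y) :: s2)) =
      c *: rho' (m b (v :: take i (s1 ++ x :: s2))) (drop i (s1 ++ x :: s2)) +
      rho' (m b (v :: take i (s1 ++ y :: s2))) (drop i (s1 ++ y :: s2)).
    case: (split_seq s1 s2 i) => -[Ht Hd]; rewrite !Ht !Hd; first by rewrite r2.
    by rewrite (ml (v :: s1)) l2.
  have E3 i j z : z = c *: x + y ->
      rho' (ssign v) (map (@ssign K A) (take i (s1 ++ z :: s2)) ++
        m b (take j (drop i (s1 ++ z :: s2))) :: drop (i + j) (s1 ++ z :: s2)) =
      c *: rho' (ssign v) (map (@ssign K A) (take i (s1 ++ x :: s2)) ++
        m b (take j (drop i (s1 ++ x :: s2))) :: drop (i + j) (s1 ++ x :: s2)) +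
      rho' (ssign v) (map (@ssign K A) (take i (s1 ++ y :: s2)) ++
        m b (take j (drop i (s1 ++ y :: s2))) :: drop (i + j) (s1 ++ y :: s2)).
    move=> ->; rewrite ![(i + j)%N]addnC -!drop_drop.
    case: (split_seq s1 s2 i) => -[Ht Hd]; rewrite !Ht !Hd; last first.
      by rewrite !map_cat /= -!catA ssign_lin r2.
    case: (split_seq (drop i s1) s2 j) => -[Ht' Hd']; rewrite !Ht' !Hd'.
      have := r2 (ssign v) (map (@ssign K A) (take i s1) ++
        m b (take j (drop i s1)) :: drop j (drop i s1)) s2 c x y.
      by rewrite -!catA.
    by rewrite ml r2.
  apply: three_sum; rewrite scaler_sumr -big_split; apply: eq_bigr => i _.
  + exact: E1.
  + exact: E2.
  + by rewrite scaler_sumr -big_split; apply: eq_bigr => j _; exact: E3.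
- by move=> v s es; case/splitPr: es => s1 s2; exact: mu1_reduced.
- move=> dv ds v s hv hs; rewrite /end_mu1.
  have dsE i : \sum_(d' <- ds) d' =
    \sum_(d' <- take i ds) d' + \sum_(d' <- drop i ds) d' := sum_take_drop i ds.
  apply: homogD; first apply: homogD.
  + rewrite -scaleN1r; apply: homog_scale; apply: homog_sum => i _.
    have li : (i <= size s)%N by rewrite -ltnS.
    have hi := h1 _ _ _ _ hv (homogs_take i hs).
    apply: homog_eqd (md [:: _ & drop i ds] [:: _ & drop i s]
      (conj hi (homogs_drop i hs))).
    rewrite big_cons (size_takel li) /= size_drop (dsE i).
    move: (maslov b) (\sum_(d' <- take i ds) d') (\sum_(d' <- drop i ds) d').
    by move=> mu x y; lia.
  + apply: homog_sum => i _; have li : (i <= size s)%N by rewrite -ltnS.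
    have hi := md [:: dv & take i ds] [:: v & take i s]
      (conj hv (homogs_take i hs)).
    apply: homog_eqd (h2 _ _ _ _ hi (homogs_drop i hs)).
    rewrite big_cons /= (size_takel li) size_drop (dsE i).
    move: (maslov b) (\sum_(d' <- take i ds) d') (\sum_(d' <- drop i ds) d').
    by move=> mu x y; lia.
  + apply: homog_sum => i _; apply: homog_sum => j ij.
    have hi := md _ _ (homogs_take j (homogs_drop i hs)).
    have hl := homogs_ssign (homogs_take i hs).
    have hr := homogs_drop (i + j) hs.
    have ht := homogs_cat hl ((conj hi hr) : homogs (_ :: _) (_ :: _)).
    apply: homog_eqd (h2 _ _ _ _ (ssign_homog hv) ht).
    have li : (i <= size s)%N by lia.
    have lj : (j <= size (drop i s))%N by rewrite size_drop; lia.
    rewrite big_cat big_cons size_cat /= size_map (size_takel li).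
    rewrite (size_takel lj) size_drop.
    rewrite (dsE i) (sum_take_drop j (drop i ds)).
    rewrite [(i + j)%N]addnC -drop_drop.
    move: (maslov b) (\sum_(d' <- take i ds) d')
      (\sum_(d' <- take j (drop i ds)) d')
      (\sum_(d' <- drop j (drop i ds)) d').
    by move=> mu x y z; lia.
Qed.

End Mu1.

Definition endo_sign (rho : endo) : endo := @gsign K end_graded rho.

Lemma endo_sign_lin c x y :
  endo_sign (c *: x + y) = c *: endo_sign x + endo_sign y.
Proof. exact: (@gsign_lin K end_graded). Qed.

Lemma endo_signE d (rho : endo) : endo_homog d rho ->
  val (endo_sign rho) = (-1) ^ d *: val rho.
Proof.
by move=> h; rewrite /endo_sign (@gsignE K end_graded d rho h); exact: endo_valZ.
Qed.

Lemma endo_ind (P : endo -> Prop) :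
  P 0 -> (forall c x y, P x -> P y -> P (c *: x + y)) ->
  (forall d x, endo_homog d x -> P x) -> forall x, P x.
Proof. exact: (@homog_ind K end_graded). Qed.

Lemma end_mu1_closed b (rho : endo) :
  end_mu1 b (val rho) (val (endo_sign rho)) \in end_pred.
Proof.
elim/endo_ind: rho => [|c x y Hx Hy|d x hx].
- apply: (@end_homog_pred (0 + (1 - maslov b))).
  rewrite (endo_signE (endo_homog0 0)); apply: end_mu1_homog.
  exact: (endo_homog0 0).
- by rewrite endo_sign_lin !endo_valP end_mu1_lin; apply: (proj2 end_submod_closed).
- rewrite (endo_signE hx); apply: end_homog_pred.
  exact: (end_mu1_homog hx b).
Qed.

Lemma end_comp_linl c (r1 r2 t : family) :
  end_comp (c *: r1 + r2) t = c *: end_comp r1 t + end_comp r2 t.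
Proof.
apply/funext => v; apply/funext => s.
by rewrite /end_comp !(addrfctE, scalrfctE) scaler_sumr -big_split.
Qed.

Lemma endo_linl (r : endo) s c x y :
  val r (c *: x + y) s = c *: val r x s + val r y s.
Proof.
elim/endo_ind: r => [|k r1 r2 H1 H2|d r hr]; last exact: (eh_linl hr).
  by rewrite scaler0 addr0.
rewrite endo_valP.
change (k *: val r1 (c *: x + y) s + val r2 (c *: x + y) s =
  c *: (k *: val r1 x s + val r2 x s) + (k *: val r1 y s + val r2 y s)).
by rewrite H1 H2 !scalerDr !scalerA [c * k]mulrC addrACA.
Qed.

Lemma end_comp_linr c (r : endo) (t1 t2 : family) :
  end_comp (val r) (c *: t1 + t2) =
  c *: end_comp (val r) t1 + end_comp (val r) t2.
Proof.
apply/funext => v; apply/funext => s.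
rewrite /end_comp !(addrfctE, scalrfctE) scaler_sumr -big_split /=.
apply: eq_bigr => i _.
exact: endo_linl.
Qed.

Lemma end_comp_closed (rho tau : endo) :
  end_comp (val rho) (val tau) \in end_pred.
Proof.
elim/endo_ind: rho => [|c x y Hx Hy|d x hx].
- have -> : end_comp (val (0 : endo)) (val tau) = 0.
    by apply/funext => v; apply/funext => s; rewrite /end_comp big1.
  exact: (proj1 end_submod_closed).
- by rewrite endo_valP end_comp_linl; apply: (proj2 end_submod_closed).
elim/endo_ind: tau => [|c z y Hx Hy|d' z hz].
- apply: (end_homog_pred (end_comp_homog hx (end_homog0 0))).
- by rewrite endo_valP end_comp_linr; apply: (proj2 end_submod_closed).
- exact: (end_homog_pred (end_comp_homog hx hz)).
Qed.

Definition endo_mu0 (b : G) : endo := Endo (end_homog_pred (end_mu0_homog b)).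

Definition endo_mu1 (b : G) (rho : endo) : endo := Endo (end_mu1_closed b rho).

Definition endo_mu2 (rho tau : endo) : endo :=
  Endo (end_comp_closed (endo_sign rho) tau).

Definition endo_op (b : G) (s : seq end_graded) : end_graded :=
  match s with
  | [::] => endo_mu0 b
  | [:: rho] => endo_mu1 b rho
  | [:: rho; tau] => if b == dzero G then endo_mu2 rho tau else 0
  | _ => 0
  end.

Lemma endo_mu1_lin b c (x y : endo) :
  endo_mu1 b (c *: x + y) = c *: endo_mu1 b x + endo_mu1 b y.
Proof.
apply: val_inj; rewrite endo_valP.
have := end_mu1_lin b c (val x) (val y) (val (endo_sign x)) (val (endo_sign y)).
by rewrite -!endo_valP -endo_sign_lin.
Qed.

Lemma endo_mu2_linl c (x y z : endo) :
  endo_mu2 (c *: x + y) z = c *: endo_mu2 x z + endo_mu2 y z.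
Proof.
apply: val_inj; rewrite endo_valP.
have := end_comp_linl c (val (endo_sign x)) (val (endo_sign y)) (val z).
by rewrite -!endo_valP -endo_sign_lin.
Qed.

Lemma endo_mu2_linr c (x y z : endo) :
  endo_mu2 z (c *: x + y) = c *: endo_mu2 z x + endo_mu2 z y.
Proof.
apply: val_inj; rewrite endo_valP.
have := end_comp_linr c (endo_sign z) (val x) (val y).
by rewrite -!endo_valP.
Qed.

Lemma endo_op_multilinear b : multilinear (endo_op b).
Proof.
have Z c : c *: (0 : endo) + 0 = 0 by rewrite scaler0 addr0.
case=> [|r [|r' s1]] [|t [|t' s2]] c x y //=; try exact: esym (Z c).
- exact: endo_mu1_lin.
- by case: ifP => _; [exact: endo_mu2_linl|exact: esym (Z c)].
- by case: ifP => _; [exact: endo_mu2_linr|exact: esym (Z c)].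
- by case: s1 => [|? ?]; exact: esym (Z c).
- by case: s1 => [|? ?]; exact: esym (Z c).
- by case: s1 => [|? ?]; exact: esym (Z c).
Qed.

Definition EndA : ainftyData G K := AinftyData endo_op_multilinear.

(* The formulas for mu_1 and mu_2 on homogeneous elements.                    *)
Lemma endo_mu1E b d (rho : endo) dv ds v s :
  endo_homog d rho -> homog A dv v -> homogs ds s ->
  endo_mu1 b rho v s =
  - (\sum_(i < (size s).+1) m b (rho v (take i s) :: drop i s))
  + \sum_(i < (size s).+1) (-1) ^ d *: rho (m b (v :: take i s)) (drop i s)
  + \sum_(i < (size s).+1) \sum_(j < (size s).+1 | (i + j <= size s)%N)
      (-1) ^ (d + (dv - 1) + \sum_(d' <- take i ds) (d' - 1)) *:
      rho v (take i s ++ m b (take j (drop i s)) :: drop (i + j) s).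
Proof.
move=> hrho hv hs; rewrite /= (endo_signE hrho) /end_mu1; congr (_ + _).
have [l1 r1 _ _] := hrho.
apply: eq_bigr => i _; apply: eq_bigr => j _.
rewrite scalrfctE /= scalrfctE (multilin_sgn (r1 _) [::] _ (homogs_take i hs)) /=.
rewrite (ssignE hv) -[_ *: v]addr0 l1 (fam0l (l1 _)) addr0 !scalerA.
by rewrite !signD; congr (_ ^ _ *: _); lia.
Qed.

Lemma endo_mu2E d (rho tau : endo) v s : endo_homog d rho ->
  endo_mu2 rho tau v s =
  (-1) ^ d *: \sum_(i < (size s).+1) rho (tau v (take i s)) (drop i s).
Proof. by move=> h; rewrite /= (endo_signE h) /end_comp scaler_sumr. Qed.

End EndA.

(* Main.v *)
Require Import Defs.
From mathcomp Require Import all_boot all_order all_algebra.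
From mathcomp Require Import reals.
From HB Require Import structures.
From mathcomp Require Import generic_quotient ring_quotient.
From mathcomp Require Import finmap boolp classical_sets functions cardinality.
From mathcomp Require Import fsbigop zify ssrAC.

Set Implicit Arguments.
Unset Strict Implicit.
Unset Printing Implicit Defensive.
Import Order.TTheory GRing.Theory Num.Theory.
Local Open Scope classical_set_scope.
Local Open Scope ring_scope.

(** Let T(A) be the tensor coalgebra of A and regard A as a right module over
    itself. An element of End_A is the same thing as an endomorphism of the
    comodule A (x) T(A), and all the operations of End_A come from one operator:
    the differential D of this comodule, which applies the operations m_b to
    every block of consecutive entries, except that m_0 is never inserted in
    front of the module variable.

    - With commutators taken in the graded sense, mu_1 rho = - [D, rho], and
      mu_2 is composition up to sign. The coderivation of T(A) squares to zero
      ([bar_sq]), so that the insertion which D leaves out is the only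
      obstruction to D^2 = 0, and D^2 = - mu_0 ([comod_sq]). The four nontrivial
      relations of the dg-algebra are then [D, D^2] = 0 ([endo_fun_mu1_mu0]),
      [D, [D, rho]] = [D^2, rho] ([endo_fun_mu1_mu1]), the Leibniz rule
      ([endo_fun_mu1_mu2]) and associativity ([endo_fun_mu2_assoc]).

    - The quasi-isomorphism is left multiplication,
        F_b(a_1, .., a_k)(v, t_1, .., t_s) = m_b(a_1, .., a_k, v, t_1, .., t_s)
      for k > 0, with F_b = 0 for k = 0. Its relations are the A-infinity
      relations of A on (a, v, t), sorted by the position of the inner block
      ([bar_cat]): inside a it gives the right-hand side, across the cut it gives
      mu_2 and the first half of mu_1, from v onwards the second half of mu_1.

    - Evaluation at the unit, rho |-> rho_0(e), inverts F_1 up to sign and up to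
      the homotopy h(rho)(v, t) = rho(e, v, t): the unit annihilates all
      operations but m_2, so that
        h mu_1 - mu_1 h = (rho |-> (-1)^|rho| rho - F_1(rho_0(e)))
      ([yoneda_homotopy]). Hence F_1 is bijective in cohomology.

    Koszul signs are carried by the linear map [ssign] acting on entries, so that
    nearly all identities hold between multilinear functions of arbitrary
    sequences and degrees enter only when sequences are compared with the
    homogeneous form of the relations. *)

Section Pointwise.
Variables (T : Type) (K : fieldType) (V : lmodType K).
Implicit Types f g : T -> V.

Lemma fctD f g x : (f + g) x = f x + g x. Proof. by []. Qed.
Lemma fctN f x : (- f) x = - f x. Proof. by []. Qed.
Lemma fctZ (c : K) f x : (c *: f) x = c *: f x. Proof. by []. Qed.

Lemma fct_sum (I : Type) (r : seq I) (P : pred I) (F : I -> T -> V) x :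
  (\sum_(i <- r | P i) F i) x = \sum_(i <- r | P i) F i x.
Proof. by elim/big_rec2: _ => // i y z _ <-. Qed.

End Pointwise.

(** * Sums over the decompositions of an element of the monoid *)

Section Splits.
Variables (R : realType) (G : discreteSubmonoid R).
Implicit Types (b : G) (p : G * G).

Definition split_pairs b : seq (G * G) := fset_set (splits b).

Lemma mem_split_pairs b p : (p \in split_pairs b) = (val p.1 + val p.2 == val b).
Proof.
rewrite /split_pairs in_fset_set ?asboolE; last exact: splits_finite.
by apply/idP/eqP => [/set_mem|h]//; apply/mem_set.
Qed.

Lemma split_pairs_uniq b : uniq (split_pairs b). Proof. exact: fset_uniq. Qed.

Lemma fsbig_splits (V : nmodType) b (F : G * G -> V) :
  \sum_(p \in splits b) F p = \sum_(p <- split_pairs b) F p.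
Proof. by rewrite fsbig_finite//; exact: splits_finite. Qed.

Lemma split_pairs_swap (V : nmodType) b (F : G -> G -> V) :
  \sum_(p <- split_pairs b) F p.1 p.2 = \sum_(p <- split_pairs b) F p.2 p.1.
Proof.
have sK : involutive (fun p : G * G => (p.2, p.1)) by case.
rewrite -(big_map (fun p : G * G => (p.2, p.1)) xpredT (fun p => F p.1 p.2)).
apply: perm_big; apply: uniq_perm;
  rewrite ?(map_inj_uniq (inv_inj sK)) ?split_pairs_uniq//.
move=> p; rewrite -[p in RHS]sK (mem_map (inv_inj sK)) !mem_split_pairs /=.
by rewrite addrC.
Qed.

(** Both sides range over the triples with sum [b]. *)
Lemma split_pairs_assoc (V : nmodType) b (F : G -> G -> G -> V) :
  \sum_(p <- split_pairs b) \sum_(q <- split_pairs p.1) F q.1 q.2 p.2 =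
  \sum_(p <- split_pairs b) \sum_(q <- split_pairs p.2) F p.1 q.1 q.2.
Proof.
have E1 : \sum_(p <- split_pairs b) \sum_(q <- split_pairs p.1) F q.1 q.2 p.2 =
  \sum_(t <- [seq (q.1, q.2, p.2) | p <- split_pairs b, q <- split_pairs p.1])
    F t.1.1 t.1.2 t.2.
  by rewrite big_allpairs_dep.
have E2 : \sum_(p <- split_pairs b) \sum_(q <- split_pairs p.2) F p.1 q.1 q.2 =
  \sum_(t <- [seq (p.1, q.1, q.2) | p <- split_pairs b, q <- split_pairs p.2])
    F t.1.1 t.1.2 t.2.
  by rewrite big_allpairs_dep.
rewrite E1 E2; apply: perm_big; apply: uniq_perm.
- apply: allpairs_uniq_dep; first exact: split_pairs_uniq.
    by move=> p _; exact: split_pairs_uniq.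
  move=> x y /allpairsPdep[p [q [_ pq ->]]] /allpairsPdep[p' [q' [_ pq' ->]]] /=.
  case: p q p' q' pq pq' => [p1 p2] [q1 q2] [p1' p2'] [q1' q2'] /=.
  rewrite !mem_split_pairs /= => /eqP pq /eqP pq' [? ? ?]; subst.
  by have -> : p1 = p1' by apply: val_inj; exact: etrans (esym pq) pq'.
- apply: allpairs_uniq_dep; first exact: split_pairs_uniq.
    by move=> p _; exact: split_pairs_uniq.
  move=> x y /allpairsPdep[p [q [_ pq ->]]] /allpairsPdep[p' [q' [_ pq' ->]]] /=.
  case: p q p' q' pq pq' => [p1 p2] [q1 q2] [p1' p2'] [q1' q2'] /=.
  rewrite !mem_split_pairs /= => /eqP pq /eqP pq' [? ? ?]; subst.
  by have -> : p2 = p2' by apply: val_inj; exact: etrans (esym pq) pq'.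
- have HG (x y : G) : {z : G | val z = val x + val y}.
    have xy : val x + val y \in (G : set _).
      by apply/mem_set; apply: dsmD; exact/set_mem/valP.
    by exists (exist (fun z => z \in (G : set _)) _ xy).
  move=> [[x y] z]; apply/allpairsPdep/allpairsPdep => -[p [q []]];
    rewrite !mem_split_pairs => /eqP hp /eqP hq [-> -> ->].
  + have [w hw] := HG q.2 p.2; exists (q.1, w), (q.2, p.2); split=> //.
    * rewrite mem_split_pairs; apply/eqP; apply: etrans hp.
      by rewrite -hq -addrA; congr (_ + _).
    * by rewrite mem_split_pairs; apply/eqP; exact: esym hw.
  + have [w hw] := HG p.1 q.1; exists (w, q.2), (p.1, q.1); split=> //.
    * rewrite mem_split_pairs; apply/eqP; apply: etrans hp.
      by rewrite -hq addrA; congr (_ + _).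
    * by rewrite mem_split_pairs; apply/eqP; exact: esym hw.
Qed.

Lemma split_pairs_zerol (V : nmodType) b (F : G -> V) :
  \sum_(p <- split_pairs b) (if p.1 == dzero G then F p.2 else 0) = F b.
Proof.
rewrite (bigD1_seq (dzero G, b)) ?split_pairs_uniq ?mem_split_pairs/= ?add0r// eqxx.
rewrite big_seq_cond big1 ?addr0// => -[x y] /=.
rewrite mem_split_pairs /= => /andP[/eqP xy].
case: (x =P dzero G) => // x0; rewrite x0 /= add0r in xy; rewrite x0.
by rewrite (val_inj xy) eqxx.
Qed.

Lemma split_pairs_zeror (V : nmodType) b (F : G -> V) :
  \sum_(p <- split_pairs b) (if p.2 == dzero G then F p.1 else 0) = F b.
Proof.
rewrite -[RHS]split_pairs_zerol.
by rewrite (split_pairs_swap b (fun x y => if y == dzero G then F x else 0)).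
Qed.

(** A nonzero element of energy zero has a nonzero Maslov index, so that its
    multiples are infinitely many elements of energy zero. *)
Lemma energy0_eq0 (x : G) : (val x).1 = 0 -> x = dzero G.
Proof.
move=> x0; apply: val_inj; apply/eqP; apply: contraT => xn.
have k0 : (val x).2 != 0.
  by apply: contraNneq xn => k0; rewrite /= [sval x]surjective_pairing x0 k0.
have xG n : dsm_set G (0, (val x).2 *+ n).
  elim: n => [|n IH]; first exact: dsm0.
  rewrite mulrS; suff -> : (0, (val x).2 + (val x).2 *+ n) =
    val x + (0, (val x).2 *+ n) by apply: dsmD => //; exact: set_mem (valP x).
  by rewrite [RHS]surjective_pairing; congr pair; rewrite /= x0 addr0.
have /(finite_preimage (f := fun n : nat => (0 : R, (val x).2 *+ n))) :=
  dsm_fin G (lexx (0 : R)).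
move=> H; exfalso; apply: infinite_nat; apply: sub_finite_set (H _).
  by move=> n _; split=> //; exact: xG.
by move=> n n' _ _ [] /(mulrIn k0).
Qed.

Lemma split_pairs_dzero (p : G * G) : p \in split_pairs (dzero G) -> p = (dzero G, dzero G).
Proof.
case: p => x y; rewrite mem_split_pairs => /eqP xy.
have x0 := dsm_ge0 (set_mem (valP x)); have y0 := dsm_ge0 (set_mem (valP y)).
have E : (val x).1 + (val y).1 = 0.
  by rewrite -[LHS]/((val x + val y).1) xy.
have [/eqP x1 /eqP y1] : (val x).1 == 0 /\ (val y).1 == 0.
  by apply/andP; rewrite -paddr_eq0// E.
by rewrite (energy0_eq0 x1) (energy0_eq0 y1).
Qed.

Lemma big_split_pairs_dzero (V : nmodType) (F : G * G -> V) :
  \sum_(p <- split_pairs (dzero G)) F p = F (dzero G, dzero G).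
Proof.
rewrite (bigD1_seq (dzero G, dzero G)) ?split_pairs_uniq ?mem_split_pairs/= ?add0r//.
by rewrite big_seq_cond big1 ?addr0// => p /andP[/split_pairs_dzero ->]; rewrite eqxx.
Qed.

End Splits.

(** * Composition and the bar differential *)

Section Bar.
Variables (R : realType) (G : discreteSubmonoid R) (K : fieldType).
Variable A : ainftyData G K.
Local Notation m := (aop A).
Implicit Types (g h : seq A -> A) (b : G) (s t : seq A).

(** Composition of endomorphisms of the comodule A (x) T(A), written for functions
    of a whole sequence: the first entry plays the role of the module variable,
    and the empty prefix is allowed so that the operations of arity zero are
    covered. *)
Definition hcomp (V : lmodType K) (f : seq A -> V) g : seq A -> V :=
  fun s => \sum_(j < (size s).+1) f (g (take j s) :: drop j s).

(** The composite of [f] with the coderivation of T(A) generated by m_b; [ssign] is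
    the Koszul sign of moving m_b past an entry. *)
Definition bar_diff (V : lmodType K) b (f : seq A -> V) : seq A -> V := fun s =>
  \sum_(i < (size s).+1) \sum_(j < (size s).+1 | (i + j <= size s)%N)
    f (map (@ssign K A) (take i s) ++ m b (take j (drop i s)) :: drop (i + j) s).

Section OneTarget.
Variable V : lmodType K.
Implicit Types f : seq A -> V.

Lemma hcomp_nil f g : hcomp f g [::] = f [:: g [::]].
Proof. by rewrite /hcomp big_ord_recl big_ord0 addr0. Qed.

Lemma hcomp_cons f g a s : hcomp f g (a :: s) =
  f [:: g [::], a & s] + hcomp f (fun t => g (a :: t)) s.
Proof. by rewrite /hcomp big_ord_recl. Qed.

Lemma bar_nil b f : bar_diff b f [::] = f [:: m b [::]].
Proof.
by rewrite /bar_diff big_ord_recl big_ord0 addr0 big_mkcond big_ord_recl big_ord0 /= addr0.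
Qed.

(** The inserted block contains the first entry or is empty in front of it, or else
    it lies to the right of the first entry. This recursion replaces all
    manipulations of block positions below. *)
Lemma bar_cons b f a s : bar_diff b f (a :: s) =
  hcomp f (m b) (a :: s) + bar_diff b (fun t => f (ssign a :: t)) s.
Proof.
rewrite /bar_diff big_ord_recl; congr (_ + _).
  rewrite /hcomp big_mkcond; apply: eq_bigr => j _.
  by rewrite add0n -ltnS ltn_ord.
apply: eq_bigr => i _; rewrite big_mkcond big_ord_recr /= [X in _ + X]ifN; last first.
  by rewrite /bump /=; lia.
by rewrite addr0 [RHS]big_mkcond.
Qed.

Lemma hcompDl f1 f2 g : hcomp (f1 + f2) g = hcomp f1 g + hcomp f2 g.
Proof. by apply/funext => s; rewrite [RHS]fctD /hcomp -big_split. Qed.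

Lemma hcompZl c f g : hcomp (c *: f) g = c *: hcomp f g.
Proof. by apply/funext => s; rewrite [RHS]fctZ /hcomp scaler_sumr. Qed.

Lemma hcompNl f g : hcomp (- f) g = - hcomp f g.
Proof. by rewrite -scaleN1r hcompZl scaleN1r. Qed.

Lemma hcomp_suml (I : Type) (r : seq I) (F : I -> seq A -> V) g :
  hcomp (\sum_(i <- r) F i) g = \sum_(i <- r) hcomp (F i) g.
Proof.
apply/funext => s; rewrite [RHS]fct_sum /hcomp [RHS]exchange_big /=.
by apply: eq_bigr => j _; rewrite fct_sum.
Qed.

Lemma barD b f1 f2 : bar_diff b (f1 + f2) = bar_diff b f1 + bar_diff b f2.
Proof.
apply/funext => s; rewrite [RHS]fctD /bar_diff -[RHS]big_split; apply: eq_bigr => i _.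
by rewrite -big_split.
Qed.

Lemma barZ b c f : bar_diff b (c *: f) = c *: bar_diff b f.
Proof.
apply/funext => s; rewrite [RHS]fctZ /bar_diff scaler_sumr; apply: eq_bigr => i _.
by rewrite [RHS]scaler_sumr.
Qed.

Lemma hcompZr f c g : multilinear f -> hcomp f (c *: g) = c *: hcomp f g.
Proof.
move=> fl; apply/funext => s; rewrite [RHS]fctZ /hcomp scaler_sumr.
apply: eq_bigr => j _; exact: (multilin_scale fl [::]).
Qed.

Lemma hcompDr f g1 g2 : multilinear f ->
  hcomp f (g1 + g2) = hcomp f g1 + hcomp f g2.
Proof.
move=> fl; apply/funext => s; rewrite [RHS]fctD /hcomp -[RHS]big_split.
apply: eq_bigr => j _ /=.
by have /= := fl [::] (drop j s) 1 (g1 (take j s)) (g2 (take j s)); rewrite !scale1r.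
Qed.

Lemma hcompNr f g : multilinear f -> hcomp f (- g) = - hcomp f g.
Proof. by move=> fl; rewrite -scaleN1r hcompZr// scaleN1r. Qed.

Lemma hcomp0r f : multilinear f -> hcomp f 0 = 0.
Proof. by move=> fl; rewrite -(scale0r (0 : seq A -> A)) hcompZr// scale0r. Qed.

Lemma hcomp_sumr (I : Type) (r : seq I) f (F : I -> seq A -> A) :
  multilinear f -> hcomp f (\sum_(i <- r) F i) = \sum_(i <- r) hcomp f (F i).
Proof.
move=> fl; elim: r => [|i r IH]; first by rewrite !big_nil hcomp0r.
by rewrite !big_cons hcompDr// IH.
Qed.

Lemma multilinear_cons f x : multilinear f -> multilinear (fun t => f (x :: t)).
Proof. by move=> fl s1 s2 c y z; exact: (fl (x :: s1)). Qed.

End OneTarget.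

(** The extra term comes from the cuts where [g] is applied to the empty prefix, so
    that the output of [h] is an argument of [f] and not of [g]. *)
Lemma hcompA (V : lmodType K) (f : seq A -> V) g h : multilinear f ->
  hcomp (hcomp f g) h =
  hcomp f (hcomp g h) + hcomp (fun t => f (g [::] :: t)) h.
Proof.
move=> fl; apply/funext => s; rewrite fctD.
elim: s h => [|a s IH] h.
  by rewrite !hcomp_nil hcomp_cons !hcomp_nil addrC.
rewrite hcomp_cons IH [hcomp f g _]hcomp_cons [hcomp f (hcomp g h) _]hcomp_cons.
rewrite [X in _ = _ + X]hcomp_cons [hcomp f _ (a :: s)]hcomp_cons hcomp_nil.
have -> : (fun t => hcomp g h (a :: t)) =
    (fun t => g [:: h [::], a & t]) + hcomp g (fun t => h (a :: t)).
  by apply/funext => t; rewrite hcomp_cons.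
rewrite hcompDr// [in RHS]fctD.
by rewrite addrACA [RHS]addrC [LHS](AC (2*(2*1)) ((1*5)*(3*(4*2)))).
Qed.

Lemma hcompA0 (V : lmodType K) (f : seq A -> V) g h : multilinear f ->
  g [::] = 0 -> hcomp (hcomp f g) h = hcomp f (hcomp g h).
Proof.
move=> fl g0; rewrite hcompA// g0.
have -> : (fun t => f (0 :: t)) = 0.
  by apply/funext => t; exact: (multilin0 fl [::]).
by rewrite -(scale0r (0 : seq A -> V)) hcompZl scale0r addr0.
Qed.

(** The inserted entry is either one of the arguments of [g] or lies to the right of
    all of them. *)
Lemma bar_hcomp_cut (V : lmodType K) b (f : seq A -> V) g s : multilinear f ->
  bar_diff b (hcomp f g) s = hcomp f (bar_diff b g) s +
  \sum_(j < (size s).+1)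
    bar_diff b (fun t => f (g (map (@ssign K A) (take j s)) :: t)) (drop j s).
Proof.
move=> fl; elim: s g => [|a s IH] g.
  rewrite bar_nil hcomp_cons !hcomp_nil bar_nil big_ord_recl big_ord0 addr0.
  by rewrite bar_nil addrC.
rewrite bar_cons.
have -> : (fun t => hcomp f g (ssign a :: t)) =
    (fun t => f [:: g [::], ssign a & t]) + hcomp f (fun t => g (ssign a :: t)).
  by apply/funext => t; rewrite hcomp_cons.
rewrite barD fctD IH [X in _ = _ + X]big_ord_recl [size _]/=.
rewrite [map _ (take ord0 _)]/= [drop ord0 _]/= [bar_diff b _ (a :: s)]bar_cons.
rewrite hcompA// fctD [hcomp f (bar_diff b g) _]hcomp_cons.
have -> : (fun t => bar_diff b g (a :: t)) = (fun t => hcomp g (m b) (a :: t)) +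
    bar_diff b (fun t => g (ssign a :: t)).
  by apply/funext => t; rewrite bar_cons.
rewrite hcompDr// [in RHS]fctD bar_nil [hcomp f (hcomp _ _) _]hcomp_cons hcomp_nil.
set x1 := f _; set x2 := hcomp _ _ s; set x3 := hcomp _ _ (a :: s).
set x4 := bar_diff _ _ s; set x5 := hcomp _ _ s;
set x6 := (X in _ + (_ + (_ + X)) = _); set y6 := (X in _ = _ + (_ + X)).
have -> : y6 = x6 by apply: eq_bigr.
by rewrite [LHS](AC (3*(1*2)) ((1*(2*5))*((3*4)*6))).
Qed.

(** Leibniz rule. Here [g'] is [g] with its own Koszul sign, which arises when an
    insertion to the right of [g] is moved past [g]. Those insertions are the ones
    counted by [bar_diff b f] on the contracted sequence, minus the ones whose
    block involves the output of [g] or is empty in front of it. *)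
Lemma bar_hcomp (V : lmodType K) b (f : seq A -> V) g g' : multilinear f ->
  (forall s, ssign (g' s) = g (map (@ssign K A) s)) ->
  bar_diff b (hcomp f g) = hcomp f (bar_diff b g) + hcomp (bar_diff b f) g'
    - hcomp (hcomp f (m b)) g'.
Proof.
move=> fl gg; apply/funext => s; rewrite bar_hcomp_cut// -addrA.
congr (_ + _); rewrite -hcompNl -hcompDl.
apply: eq_bigr => j _; rewrite fctD fctN bar_cons.
by rewrite addrC addKr gg.
Qed.

Definition nonempty_part g : seq A -> A := fun s => if s is [::] then 0 else g s.

Lemma hcomp_ext (V : lmodType K) (f f' : seq A -> V) g :
  (forall x s, f (x :: s) = f' (x :: s)) -> hcomp f g = hcomp f' g.
Proof. by move=> ff; apply/funext => s; apply: eq_bigr => j _; exact: ff. Qed.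

Lemma bar_ext (V : lmodType K) b (f f' : seq A -> V) :
  (forall x s, f (x :: s) = f' (x :: s)) -> bar_diff b f = bar_diff b f'.
Proof.
move=> ff; apply/funext => s; apply: eq_bigr => i _; apply: eq_bigr => j _.
by case: (map _ _) => [|x u]; exact: ff.
Qed.

(** The prefix given to [g] stops inside [a], possibly at its end, or takes at least
    one entry of [t]; the latter case needs [nonempty_part], or else the prefix
    [a] would be counted twice. *)
Lemma hcomp_cat (V : lmodType K) (f : seq A -> V) g a t : multilinear f ->
  hcomp f g (a ++ t) = hcomp (fun a' => f (a' ++ t)) g a +
    hcomp f (nonempty_part (fun t' => g (a ++ t'))) t.
Proof.
move=> fl; elim: a g => [|x a IH] g.
  rewrite hcomp_nil /=; case: t => [|y t].
    by rewrite !hcomp_nil [X in _ + X](multilin0 fl [::]) addr0.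
  by rewrite !hcomp_cons [X in _ = _ + (X + _)](multilin0 fl [::]) add0r.
by rewrite /= !hcomp_cons IH addrA.
Qed.

End Bar.

(** * The square of the bar differential and the curvature *)

Section BarSquare.
Variables (R : realType) (G : discreteSubmonoid R) (K : fieldType).
Variable A : ainftyData G K.
Hypothesis hA : is_filtered_ainfty A.
Local Notation m := (aop A).
Local Notation aopl := (@aop_multilinear _ _ _ A).
Implicit Types (g h : seq A -> A) (b : G) (s t : seq A).

Lemma sum_shifted (ds : seq int) :
  \sum_(d <- ds) (d - 1) = \sum_(d <- ds) d - (size ds)%:Z.
Proof.
by elim: ds => [|d ds IH]; rewrite ?big_nil ?big_cons ?IH//=; lia.
Qed.

Lemma sign_maslov b : (-1 : K) ^ maslov b = 1.
Proof.
have /dvdzP[k ->] : (2 %| maslov b)%Z by exact: dsm_even (set_mem (valP b)).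
by rewrite mulrC -exprz_exp -[(-1) ^ 2]/((-1) ^+ 2) sqrrN expr1n exp1rz.
Qed.

Lemma sign_sq (d : int) : (-1 : K) ^ d * (-1) ^ d = 1.
Proof. by rewrite -exprzMl ?unitrN1// mulrNN mulr1 exp1rz. Qed.

Lemma sign_inv (d : int) : (-1 : K) ^ (- d) = (-1) ^ d.
Proof.
by rewrite -[LHS]mulr1 -[X in _ * X](sign_sq d) mulrA signD addNr expr0z mul1r.
Qed.

Lemma sign_pred (d : int) : (-1 : K) ^ (d - 1) = - (-1) ^ d.
Proof. by rewrite -signD exprN1 invrN1 mulrN1. Qed.

Lemma ssign0 : ssign (0 : A) = 0.
Proof. by rewrite (ssignE (homog0 A 0)) scaler0. Qed.

Lemma ssignK (a : A) : ssign (ssign a) = a.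
Proof.
elim/homog_ind: a => [|c x y Hx Hy|d x hx].
- by rewrite !ssign0.
- by rewrite !ssign_lin Hx Hy.
- by rewrite (ssignE (ssign_homog hx)) (ssignE hx) scalerA sign_sq scale1r.
Qed.

Lemma ssignN (a : A) : ssign (- a) = - ssign a.
Proof.
by rewrite -scaleN1r -[_ *: a]addr0 ssign_lin ssign0 addr0 scaleN1r.
Qed.

(** Maslov indices are even, so every operation is odd for the shifted degree. *)
Lemma ssign_aop b s : ssign (m b s) = - m b (map (@ssign K A) s).
Proof.
suff E : (fun s => ssign (m b s)) = (fun s => - m b (map (@ssign K A) s)).
  exact: (congr1 (fun f => f s) E).
apply: multilin_ext => [s1 s2 c x y|s1 s2 c x y|ds t ht].
- by rewrite aopl ssign_lin.
- by rewrite !map_cat /= ssign_lin aopl opprD scalerN.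
- have := multilin_sgn (aopl b) [::] [::] ht; rewrite !cats0 !cat0s => ->.
  rewrite (ssignE (aop_degree hA b ht)) sum_shifted (homogs_size ht).
  rewrite -[RHS]scaleNr; congr (_ *: _); rewrite signN.
  rewrite -[RHS]mulr1 -[X in _ = _ * X](sign_maslov b) -[_ ^ maslov b]sign_inv.
  rewrite signD; congr (_ ^ _).
  by move: (maslov b) (\sum_(d <- ds) d); lia.
Qed.

Lemma hcomp_multilinear (V : lmodType K) (f : seq A -> V) g :
  multilinear f -> multilinear g -> multilinear (hcomp f g).
Proof.
move=> fl gl s1; elim: s1 g gl => [|a s1 IH] g gl s2 c x y /=.
  rewrite !hcomp_cons.
  have -> : (fun t => g (c *: x + y :: t)) =
      c *: (fun t => g (x :: t)) + (fun t => g (y :: t)).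
    by apply/funext => t; exact: (gl [::]).
  rewrite hcompDr// hcompZr// fctD fctZ.
  have := fl [:: g [::]] s2 c x y; rewrite /= => ->.
  by rewrite scalerDr addrACA.
rewrite !hcomp_cons IH; last exact: multilinear_cons.
have := fl [:: g [::], a & s1] s2 c x y; rewrite /= => ->.
by rewrite scalerDr addrACA.
Qed.

Lemma bar_multilinear (V : lmodType K) (f : seq A -> V) b :
  multilinear f -> multilinear (bar_diff b f).
Proof.
move=> fl s1; elim: s1 f fl => [|a s1 IH] f fl s2 c x y /=.
  rewrite !bar_cons.
  have /= -> := hcomp_multilinear fl (aopl b) [::] s2 c x y.
  have -> : (fun t => f (ssign (c *: x + y) :: t)) =
      c *: (fun t => f (ssign x :: t)) + (fun t => f (ssign y :: t)).
    by apply/funext => t; rewrite ssign_lin; exact: (fl [::]).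
  by rewrite barD barZ fctD fctZ scalerDr addrACA.
rewrite !bar_cons IH; last exact: multilinear_cons.
have /= -> := hcomp_multilinear fl (aopl b) (a :: s1) s2 c x y.
by rewrite scalerDr addrACA.
Qed.

Lemma bar_sumE (B : ainftyData G K) (V : lmodType K) (F : G -> seq B -> V)
    b ds (s : seq B) : (forall b', multilinear (F b')) -> homogs ds s ->
  bar_sum F b ds s = \sum_(p <- split_pairs b) bar_diff p.1 (F p.2) s.
Proof.
move=> Fl hs; rewrite /bar_sum fsbig_splits.
apply: eq_bigr => p _; apply: eq_bigr => i _; apply: eq_bigr => j _.
by have := multilin_sgn (Fl p.2) [::] _ (homogs_take i hs) => /= ->.
Qed.

(** The A-infinity relations without signs: no homogeneity is assumed. *)
Lemma bar_aop b : \sum_(p <- split_pairs b) bar_diff p.1 (m p.2) = 0.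
Proof.
apply: multilin_ext => [s1 s2 c x y|s1 s2 c x y|ds s hs].
- rewrite !fct_sum scaler_sumr -big_split; apply: eq_bigr => p _.
  exact: bar_multilinear (aopl _) _ _ _ _ _.
- by rewrite scaler0 addr0.
- rewrite fct_sum -[RHS](aop_rel hA b hs) bar_sumE//; exact: aopl.
Qed.

(** The insertions to the right of the first entry. *)
Definition bar_tail (V : lmodType K) b (f : seq A -> V) : seq A -> V :=
  fun s => if s is a :: s' then bar_diff b (fun t => f (ssign a :: t)) s' else 0.

Lemma barE (V : lmodType K) b (f : seq A -> V) :
  bar_diff b f = hcomp f (m b) + bar_tail b f.
Proof.
apply/funext => -[|a s]; rewrite fctD; last by rewrite bar_cons.
by rewrite bar_nil hcomp_nil addr0.
Qed.

Lemma multilinear_lin (V : lmodType K) (f1 f2 : seq A -> V) k :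
  multilinear f1 -> multilinear f2 -> multilinear (k *: f1 + f2).
Proof.
move=> l1 l2 s1 s2 c x y; rewrite !fctD !fctZ l1 l2.
by rewrite !scalerDr !scalerA [c * k]mulrC addrACA.
Qed.

Lemma multilinearD (V : lmodType K) (f1 f2 : seq A -> V) :
  multilinear f1 -> multilinear f2 -> multilinear (f1 + f2).
Proof. by move=> l1 l2; rewrite -[f1]scale1r; exact: multilinear_lin. Qed.

Lemma multilinearN (V : lmodType K) (f1 : seq A -> V) :
  multilinear f1 -> multilinear (- f1).
Proof.
move=> l1 s1 s2 c x y; rewrite !fctN l1.
by rewrite opprD scalerN.
Qed.

(** Membership of the values in a subspace can be tested on homogeneous sequences,
    one entry at a time. *)
Lemma multilinear_closed (V : lmodType K) (S : {pred V}) (f : seq A -> V) :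
  multilinear f -> submod_closed S -> (forall ds s, homogs ds s -> f s \in S) ->
  forall s, f s \in S.
Proof.
move=> fl [S0 Sl] Sh s; rewrite -[s]cat0s.
have : homogs [::] ([::] : seq A) by [].
move: [::] [::] => s1 ds1; elim: s ds1 s1 => [|x s IH] ds1 s1 h1.
  by rewrite cats0; exact: Sh h1.
elim/homog_ind: x => [|c x y Hx Hy|d x hx].
- by rewrite (multilin0 fl).
- by rewrite fl; exact: Sl.
- rewrite -cat_rcons; apply: (IH (rcons ds1 d)).
  by rewrite -!cats1; apply: homogs_cat.
Qed.

Lemma bar_tail_multilinear (V : lmodType K) b (f : seq A -> V) :
  multilinear f -> multilinear (bar_tail b f).
Proof.
move=> fl; have -> : bar_tail b f = bar_diff b f + - hcomp f (m b).
  by rewrite barE addrC addKr.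
apply: multilinearD; first exact: bar_multilinear.
apply: multilinearN; apply: hcomp_multilinear => //; exact: aopl.
Qed.

(** The Leibniz rule for [g = m b'], which is odd. *)
Lemma bar_bar (V : lmodType K) b b' (f : seq A -> V) : multilinear f ->
  bar_diff b (bar_diff b' f) = hcomp f (bar_diff b (m b')) +
    (hcomp (bar_tail b' f) (m b) - hcomp (bar_tail b f) (m b'))
    + bar_tail b (bar_tail b' f).
Proof.
move=> fl; rewrite [bar_diff b' f]barE barD.
rewrite (bar_hcomp (g' := - m b') b fl) => [|s]; last first.
  by rewrite fctN ssignN ssign_aop opprK.
rewrite -[_ + _ - _]addrA -hcompNl -hcompDl {1}[bar_diff b f]barE.
rewrite [_ + bar_tail b f]addrC addrK.
rewrite [bar_diff b (bar_tail _ _)]barE hcompNr; last exact: bar_tail_multilinear.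
by rewrite -!addrA; congr (_ + _); rewrite addrCA.
Qed.

(** In [bar_bar], the first term vanishes by the A-infinity relations, the
    difference by the symmetry of the sum in the two energies, and the last term
    is the same statement for the sequence without its first entry. *)
Lemma bar_sq (V : lmodType K) b (f : seq A -> V) : multilinear f ->
  \sum_(p <- split_pairs b) bar_diff p.1 (bar_diff p.2 f) = 0.
Proof.
move=> fl; apply/funext => s; elim: s f fl => [|a s IH] f fl;
  rewrite (eq_bigr _ (fun p _ => bar_bar p.1 p.2 fl)) !big_split /=;
  rewrite sumrN -hcomp_sumr// bar_aop hcomp0r// add0r;
  rewrite (split_pairs_swap b (fun x y => hcomp (bar_tail y f) (m x))) subrr add0r;
  rewrite fct_sum /=; first by rewrite big1.
rewrite -[RHS](IH (fun t => f (a :: t))) ?fct_sum; last exact: multilinear_cons.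
apply: eq_bigr => p _; congr (bar_diff _ _ s).
by apply/funext => t /=; rewrite ssignK.
Qed.

(** The operation m_{0,b} as a function on T(A). Composition with it inserts
    m_{0,b} in front of a sequence. *)
Definition curvature b : seq A -> A := fun s => if s is [::] then m b [::] else 0.

Definition aop_pos b : seq A -> A := fun s => if s is [::] then 0 else m b s.

(** The composite of [f] with the differential D of A (x) T(A): insertions in front of
    the module variable are removed. *)
Definition comod_diff (V : lmodType K) b (f : seq A -> V) : seq A -> V :=
  bar_diff b f - hcomp f (curvature b).

(** The curvature mu_0 of End_A: m(m_0, v, a_1, .., a_s). *)
Definition curvature_action b : seq A -> A :=
  \sum_(p <- split_pairs b) hcomp (aop_pos p.1) (curvature p.2).

Lemma comod_nil (V : lmodType K) b (f : seq A -> V) : comod_diff b f [::] = 0.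
Proof. by rewrite /comod_diff fctD fctN bar_nil hcomp_nil subrr. Qed.

Lemma hcomp_curvature (V : lmodType K) b (f : seq A -> V) s : multilinear f ->
  hcomp f (curvature b) s = f (m b [::] :: s).
Proof.
move=> fl; rewrite /hcomp big_ord_recl /= take0 drop0 big1 ?addr0// => i _.
case: s i => [|a s] i; first by case: i.
exact: (multilin0 fl [::]).
Qed.

Lemma comod_cons (V : lmodType K) b (f : seq A -> V) v s : multilinear f ->
  comod_diff b f (v :: s) = \sum_(i < (size s).+1) f (m b (v :: take i s) :: drop i s)
    + bar_diff b (fun t => f (ssign v :: t)) s.
Proof.
move=> fl; rewrite /comod_diff fctD fctN hcomp_curvature// bar_cons hcomp_cons.
by rewrite addrC !addrA addNr add0r.
Qed.

Lemma aop_split b : m b = aop_pos b + curvature b.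
Proof. by apply/funext => -[|a s]; rewrite fctD ?add0r ?addr0. Qed.

Lemma aop_pos_multilinear b : multilinear (aop_pos b).
Proof. by case=> [|a s1] s2 c x y; exact: aopl. Qed.

Lemma curvature_multilinear b : multilinear (curvature b).
Proof. by case=> [|a s1] s2 c x y; rewrite /= scaler0 addr0. Qed.

Lemma comod_multilinear (V : lmodType K) b (f : seq A -> V) :
  multilinear f -> multilinear (comod_diff b f).
Proof.
move=> fl; apply: multilinearD; first exact: bar_multilinear.
apply: multilinearN; apply: hcomp_multilinear => //; exact: curvature_multilinear.
Qed.

Lemma bar_curvature b b' : bar_diff b (curvature b') = 0.
Proof.
apply/funext => s; rewrite /bar_diff big1// => i _; rewrite big1// => j _.
by case: (map _ _).
Qed.

Lemma comodD (V : lmodType K) b (f1 f2 : seq A -> V) :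
  comod_diff b (f1 + f2) = comod_diff b f1 + comod_diff b f2.
Proof. by rewrite /comod_diff barD hcompDl opprD addrACA. Qed.

Lemma comodZ (V : lmodType K) b c (f : seq A -> V) :
  comod_diff b (c *: f) = c *: comod_diff b f.
Proof. by rewrite /comod_diff barZ hcompZl scalerBr. Qed.

Lemma comodN (V : lmodType K) b (f : seq A -> V) : comod_diff b (- f) = - comod_diff b f.
Proof. by rewrite -scaleN1r comodZ scaleN1r. Qed.

Lemma comod_sum (V : lmodType K) b (I : Type) (r : seq I) (F : I -> seq A -> V) :
  comod_diff b (\sum_(i <- r) F i) = \sum_(i <- r) comod_diff b (F i).
Proof.
elim: r => [|i r IH]; last by rewrite !big_cons comodD IH.
by rewrite !big_nil; have := comodZ b 0 (0 : seq A -> V); rewrite !scale0r.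
Qed.

(** The Leibniz rule for D: insertions involving the output of [g] are exactly the
    last term, because D never inserts in front of it. *)
Lemma comod_hcomp (V : lmodType K) b (f : seq A -> V) g g' :
  multilinear f -> g [::] = 0 ->
  (forall s, ssign (g' s) = g (map (@ssign K A) s)) ->
  comod_diff b (hcomp f g) = hcomp f (comod_diff b g) + hcomp (comod_diff b f) g'
    - hcomp f (hcomp (aop_pos b) g').
Proof.
move=> fl g0 gg; rewrite /comod_diff (bar_hcomp b fl gg) (hcompA0 _ fl g0).
rewrite [in RHS]hcompDr// hcompNr// hcompDl hcompNl aop_split hcompDr// hcompDl.
rewrite [hcomp (hcomp f (aop_pos b)) _]hcompA0//.
by rewrite opprD !addrA [RHS](AC 5 (1*3*5*4*2)).
Qed.

(** Expanding D as the bar differential minus the insertion in front, the terms of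
    mixed type cancel by symmetry, and what remains is the double insertion
    m(m_0, v, ..), which the square of D lacks. *)
Lemma comod_sq (V : lmodType K) b (f : seq A -> V) : multilinear f ->
  \sum_(p <- split_pairs b) comod_diff p.1 (comod_diff p.2 f)
  = - hcomp f (curvature_action b).
Proof.
move=> fl.
have E p : comod_diff p.1 (comod_diff p.2 f) = bar_diff p.1 (bar_diff p.2 f)
    + (hcomp (bar_diff p.1 f) (curvature p.2) - hcomp (bar_diff p.2 f) (curvature p.1))
    + (hcomp (hcomp f (curvature p.2)) (curvature p.1)
       - hcomp (hcomp f (curvature p.1)) (curvature p.2))
    - hcomp f (hcomp (aop_pos p.1) (curvature p.2)).
  rewrite /comod_diff barD -[- hcomp f _]scaleN1r barZ scaleN1r.
  rewrite (bar_hcomp (g' := - curvature p.2) p.1 fl) => [|s]; last first.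
    rewrite fctN ssignN; case: s => [|a s] /=; first by rewrite ssign_aop opprK.
    by rewrite ssign0 oppr0.
  rewrite bar_curvature hcomp0r// add0r.
  rewrite hcompNr; last exact: bar_multilinear.
  rewrite hcompNr; last by apply: hcomp_multilinear => //; exact: aopl.
  rewrite opprK hcompDl hcompNl [in hcomp (hcomp f (m _)) _]aop_split.
  rewrite hcompDr// hcompDl [hcomp (hcomp f (aop_pos _)) _]hcompA0// scaleN1r.
  rewrite !opprD !opprK !addrA.
  by rewrite [RHS](AC 6 (1*2*6*5*3*4)).
rewrite (eq_bigr _ (fun p _ => E p)) !big_split /= bar_sq// add0r !sumrN.
rewrite (split_pairs_swap b (fun x y => hcomp (bar_diff y f) (curvature x))) subrr add0r.
rewrite (split_pairs_swap b (fun x y => hcomp (hcomp f (curvature y)) (curvature x))).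
rewrite subrr add0r.
by rewrite -hcomp_sumr.
Qed.

(** The A-infinity relations read as the equation D^2 = - mu_0 of the right module
    A: the right-hand side is the one term whose inner block precedes the module
    variable. *)
Lemma comod_aop_pos b :
  \sum_(p <- split_pairs b) comod_diff p.1 (aop_pos p.2) = - curvature_action b.
Proof.
have E p : comod_diff p.1 (aop_pos p.2) =
    bar_diff p.1 (m p.2) - hcomp (aop_pos p.2) (curvature p.1).
  by rewrite /comod_diff aop_split barD bar_curvature addr0.
rewrite (eq_bigr _ (fun p _ => E p)) big_split /= bar_aop add0r sumrN.
by rewrite (split_pairs_swap b (fun x y => hcomp (aop_pos y) (curvature x))).
Qed.

Lemma comod_ext (V : lmodType K) b (f f' : seq A -> V) :
  (forall x s, f (x :: s) = f' (x :: s)) -> comod_diff b f = comod_diff b f'.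
Proof. by move=> ff; rewrite /comod_diff (bar_ext _ ff) (hcomp_ext _ ff). Qed.

(** The inserted block lies in [a] (possibly empty at its end), or it starts in [a]
    and reaches [t], or it lies in [t]; the empty block between [a] and [t] is
    counted with [a], which is why the last term is [comod_diff] and not
    [bar_diff]. *)
Lemma bar_cat (V : lmodType K) b (f : seq A -> V) a t : multilinear f ->
  bar_diff b f (a ++ t) = bar_diff b (fun a' => f (a' ++ t)) a +
    \sum_(i < size a) hcomp (fun t' => f (map (@ssign K A) (take i a) ++ t'))
      (nonempty_part (fun t' => m b (drop i a ++ t'))) t +
    comod_diff b (fun t' => f (map (@ssign K A) a ++ t')) t.
Proof.
elim: a f => [|x a IH] f fl.
  rewrite big_ord0 addr0 bar_nil /comod_diff fctD fctN hcomp_curvature//=.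
  by rewrite addrC subrK.
rewrite [(x :: a) ++ t]/= !bar_cons IH; last exact: multilinear_cons.
rewrite -[x :: a ++ t]/((x :: a) ++ t) hcomp_cat// [size _]/= big_ord_recl /=.
by rewrite [LHS](AC (2*3) (1*3*(2*4)*5)) /= !addrA.
Qed.

End BarSquare.

(** * The dg-algebra of endomorphisms *)

Section DgAlgebra.
Variables (R : realType) (G : discreteSubmonoid R) (K : fieldType).
Variable A : unitalAinfty G K.
Local Notation m := (aop A).
Local Notation hA := (ua_ainfty A).
Implicit Types (b : G) (rho tau : endo A).

(** The value on the empty sequence has to be 0: by linearity in the first entry,
    [hcomp] is then the composition of families, and it is associative. *)
Definition uncurried (f : A -> seq A -> A) : seq A -> A :=
  fun s => if s is v :: t then f v t else 0.

Definition endo_fun rho : seq A -> A := uncurried (val rho).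

Lemma endo_fun_lin c rho tau : endo_fun (c *: rho + tau) = c *: endo_fun rho + endo_fun tau.
Proof.
by apply/funext => -[|v t]; rewrite fctD fctZ /endo_fun /= ?scaler0 ?addr0// endo_valP.
Qed.

Lemma endo_funD rho tau : endo_fun (rho + tau) = endo_fun rho + endo_fun tau.
Proof. by rewrite -[rho]scale1r endo_fun_lin !scale1r. Qed.

Lemma endo_fun0 : endo_fun 0 = 0. Proof. by apply/funext => -[]. Qed.

Lemma endo_funZ c rho : endo_fun (c *: rho) = c *: endo_fun rho.
Proof. by rewrite -[c *: rho]addr0 endo_fun_lin endo_fun0 addr0. Qed.

Lemma endo_funN rho : endo_fun (- rho) = - endo_fun rho.
Proof. by rewrite -scaleN1r endo_funZ scaleN1r. Qed.

Lemma endo_fun_sum (I : Type) (r : seq I) (P : pred I) (F : I -> endo A) :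
  endo_fun (\sum_(i <- r | P i) F i) = \sum_(i <- r | P i) endo_fun (F i).
Proof. by elim/big_rec2: _ => [|i f rho _ <-]; [exact: endo_fun0|exact: endo_funD]. Qed.

Lemma endo_fun_inj : injective endo_fun.
Proof.
move=> rho tau E; apply: val_inj; apply/funext => v; apply/funext => t.
exact: (congr1 (fun f : seq A -> A => f (v :: t)) E).
Qed.

Lemma endo_fun_multilinear rho : multilinear (endo_fun rho).
Proof.
elim/endo_ind: rho => [|c x y Hx Hy|d x hx].
- have Z (c : K) : c *: (0 : A) + 0 = 0 by rewrite scaler0 addr0.
  by rewrite endo_fun0 => s1 s2 c x y; exact/esym/Z.
- by rewrite endo_fun_lin; exact: multilinear_lin.
- have [l r _ _] := hx.
  by case=> [|v s1] s2 c y z; [exact: l|exact: r].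
Qed.

Lemma endo_sign_homog d rho : endo_homog d rho -> endo_homog d (endo_sign rho).
Proof.
move=> h; rewrite /endo_homog /= (endo_signE h) -[_ *: _]addr0.
by apply: end_homog_lin => //; exact: end_homog0.
Qed.

Lemma endo_sign0 : endo_sign (0 : endo A) = 0.
Proof.
have := endo_sign_lin (-1) (0 : endo A) 0.
by rewrite scaler0 addr0 scaleN1r addNr.
Qed.

Lemma endo_fun_sign d rho : endo_homog d rho ->
  endo_fun (endo_sign rho) = (-1) ^ d *: endo_fun rho.
Proof.
move=> h; apply/funext => -[|v t]; rewrite fctZ /endo_fun /= ?scaler0//.
by rewrite (endo_signE h).
Qed.

(** [endo_sign rho] is the Koszul partner [g'] of [rho] in the Leibniz rules. *)
Lemma endo_fun_signE rho (s : seq A) :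
  ssign (endo_fun (endo_sign rho) s) = endo_fun rho (map (@ssign K A) s).
Proof.
elim/endo_ind: rho => [|c x y Hx Hy|d x hx].
- by rewrite endo_sign0 endo_fun0 ssign0.
- by rewrite endo_sign_lin !endo_fun_lin !fctD !fctZ ssign_lin Hx Hy.
case: s => [|v t]; first by rewrite /= ssign0.
have h' := endo_sign_homog hx.
rewrite /endo_fun /= /ssign (gsign_family h') opprK.
by rewrite fctZ /= (endo_signE hx) fctZ /= scalerA sign_sq scale1r.
Qed.

Lemma endo_signK rho : endo_sign (endo_sign rho) = rho.
Proof.
elim/endo_ind: rho => [|c x y Hx Hy|d x hx].
- by rewrite !endo_sign0.
- by rewrite !endo_sign_lin Hx Hy.
have h' := endo_sign_homog hx.
apply: endo_fun_inj; rewrite (endo_fun_sign h') (endo_fun_sign hx) scalerA sign_sq.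
exact: scale1r.
Qed.

Lemma uncurried_comp (f g : A -> seq A -> A) : multilinear (uncurried f) ->
  uncurried (end_comp f g) = hcomp (uncurried f) (uncurried g).
Proof.
move=> fl; apply/funext => -[|v s] /=.
  by rewrite hcomp_nil; exact/esym/(multilin0 fl [::]).
by rewrite /hcomp big_ord_recl [X in _ = X + _](multilin0 fl [::]) add0r.
Qed.

Lemma endo_fun_mu2 rho tau :
  endo_fun (endo_mu2 rho tau) = hcomp (endo_fun (endo_sign rho)) (endo_fun tau).
Proof. by apply: uncurried_comp; exact: endo_fun_multilinear. Qed.

(** This is mu_1 rho = - [D, rho]. *)
Lemma endo_fun_mu1 b rho : endo_fun (endo_mu1 b rho) =
  - hcomp (aop_pos b) (endo_fun rho) + comod_diff b (endo_fun (endo_sign rho)).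
Proof.
have fl := endo_fun_multilinear (endo_sign rho).
apply/funext => -[|v s]; rewrite fctD fctN.
  rewrite comod_nil hcomp_nil [aop_pos b _](multilin0 (aop_pos_multilinear b) [::]).
  by rewrite oppr0 addr0.
rewrite comod_cons// /endo_fun /= /end_mu1 -addrA; congr (- _ + _).
rewrite /hcomp [in RHS]big_ord_recl.
by rewrite [X in _ = X + _](multilin0 (aop_pos_multilinear b) [::]) add0r.
Qed.

(** On the empty sequence the left-hand side is 0 by convention, and the right-hand
    side vanishes by the A-infinity relation without entries. *)
Lemma endo_fun_mu0 b : endo_fun (endo_mu0 A b) = @curvature_action _ _ _ A b.
Proof.
apply/funext => -[|v s]; rewrite /curvature_action fct_sum.
  have := congr1 (fun f : seq A -> A => f [::]) (bar_aop hA b).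
  rewrite /= fct_sum => E; apply: etrans (esym E) _.
  rewrite [LHS](eq_bigr (fun p => m p.2 [:: m p.1 [::]])); last first.
    by move=> p _; rewrite bar_nil.
  rewrite (split_pairs_swap b (fun x y => m y [:: m x [::]])).
  by apply: eq_bigr => p _; rewrite hcomp_nil.
rewrite /endo_fun /= /end_mu0 fsbig_splits; apply: eq_bigr => p _.
by rewrite hcomp_curvature//; exact: aop_pos_multilinear.
Qed.

Lemma endo_mu0_homog b : endo_homog (2 - maslov b) (endo_mu0 A b).
Proof. exact: end_mu0_homog. Qed.

Lemma sign_curvature b : (-1 : K) ^ (2 - maslov b) = 1.
Proof.
by rewrite -signD sign_inv sign_maslov mulr1 -[2%R]/(2%:Z) -exprnP sqrrN expr1n.
Qed.

Lemma endo_mu1_homog d b rho : endo_homog d rho ->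
  endo_homog (d + (1 - maslov b)) (endo_mu1 b rho).
Proof.
by move=> h; rewrite /endo_homog /= (endo_signE h); exact: end_mu1_homog.
Qed.

Lemma endo_mu2_homog d d' rho tau : endo_homog d rho -> endo_homog d' tau ->
  endo_homog (d + d') (endo_mu2 rho tau).
Proof. by move=> h h'; exact: end_comp_homog (endo_sign_homog h) h'. Qed.

Lemma endo_fun_mu1_homog d b rho : endo_homog d rho -> endo_fun (endo_mu1 b rho) =
  - hcomp (aop_pos b) (endo_fun rho) + (-1) ^ d *: comod_diff b (endo_fun rho).
Proof. by move=> h; rewrite endo_fun_mu1 (endo_fun_sign h) comodZ. Qed.

(** [D, [D, rho]] is the commutator of rho with D^2 = - mu_0. *)
Lemma endo_fun_mu1_mu1 d b rho : endo_homog d rho ->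
  \sum_(p <- split_pairs b) endo_fun (endo_mu1 p.2 (endo_mu1 p.1 rho)) =
  hcomp (endo_fun rho) (curvature_action b) - hcomp (curvature_action b) (endo_fun rho).
Proof.
move=> hr; set r := endo_fun rho; pose z : K := (-1) ^ d.
have zz : z * z = 1 by exact: sign_sq.
have rl : multilinear r by exact: endo_fun_multilinear.
have ml b' : multilinear (aop_pos b') := aop_pos_multilinear (A := A) b'.
have E p : endo_fun (endo_mu1 p.2 (endo_mu1 p.1 rho)) =
    z *: (hcomp (aop_pos p.1) (comod_diff p.2 r) - hcomp (aop_pos p.2) (comod_diff p.1 r))
    + (hcomp (aop_pos p.2) (hcomp (aop_pos p.1) r) -
       hcomp (aop_pos p.1) (hcomp (aop_pos p.2) r))
    + hcomp (comod_diff p.2 (aop_pos p.1)) r - comod_diff p.2 (comod_diff p.1 r).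
  rewrite (endo_fun_mu1_homog _ (endo_mu1_homog p.1 hr)) (endo_fun_mu1_homog _ hr) -/r -/z.
  have -> : (-1 : K) ^ (d + (1 - maslov p.1)) = - z.
    by rewrite -signD -signD expr1z sign_inv sign_maslov mulr1 mulrN1.
  rewrite hcompDr// hcompNr// hcompZr// comodD comodN comodZ.
  rewrite (comod_hcomp (g' := z *: r) p.2 (ml p.1)) => [|//|s]; last first.
    by rewrite -[RHS]endo_fun_signE (endo_fun_sign hr).
  rewrite !hcompZr//.
    move: (comod_diff p.2 (comod_diff p.1 r)) => C.
    rewrite !(scaleNr, scalerDr, scalerN, opprD, opprK, scalerA, zz, scale1r).
    by rewrite !addrA [LHS](AC 6 (3*2*1*5*4*6)).
  by apply: comod_multilinear; exact: ml.
rewrite (eq_bigr _ (fun p _ => E p)) !big_split /= -scaler_sumr big_split /= !sumrN.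
rewrite (split_pairs_swap b (fun x y => hcomp (aop_pos x) (comod_diff y r))).
rewrite subrr scaler0 add0r.
rewrite (split_pairs_swap b (fun x y => hcomp (aop_pos x) (hcomp (aop_pos y) r))).
rewrite subrr add0r.
rewrite -hcomp_suml (split_pairs_swap b (fun x y => comod_diff y (aop_pos x))).
rewrite (comod_aop_pos hA) (split_pairs_swap b (fun x y => comod_diff y (comod_diff x r))).
by rewrite (comod_sq hA)// opprK hcompNl addrC.
Qed.

(** The Bianchi identity [D, D^2] = 0: both D mu_0 and mu_0 D are the sum of the
    triple products of D, bracketed in two ways. *)
Lemma endo_fun_mu1_mu0 b :
  \sum_(p <- split_pairs b) endo_fun (endo_mu1 p.2 (endo_mu0 A p.1)) = 0.
Proof.
have ml b' : multilinear (aop_pos b') := aop_pos_multilinear (A := A) b'.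
have E p : endo_fun (endo_mu1 p.2 (endo_mu0 A p.1)) =
    - hcomp (aop_pos p.2) (curvature_action p.1) + comod_diff p.2 (curvature_action p.1).
  rewrite (endo_fun_mu1_homog _ (endo_mu0_homog p.1)) endo_fun_mu0 sign_curvature.
  by rewrite scale1r.
rewrite (eq_bigr _ (fun p _ => E p)) big_split /= sumrN.
have -> : \sum_(p <- split_pairs b) comod_diff p.2 (curvature_action p.1) =
    \sum_(p <- split_pairs b) hcomp (aop_pos p.2) (@curvature_action _ _ _ A p.1).
  rewrite [LHS](eq_bigr (fun p => - \sum_(q <- split_pairs p.1)
      comod_diff p.2 (comod_diff q.2 (aop_pos q.1)))); last first.
    move=> p _; rewrite -comod_sum -comodN; congr comod_diff.
    rewrite (split_pairs_swap p.1 (fun x y => comod_diff y (aop_pos x))).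
    by rewrite (comod_aop_pos hA) opprK.
  rewrite sumrN.
  rewrite (split_pairs_assoc b (fun x y z => comod_diff z (comod_diff y (aop_pos x)))).
  rewrite -sumrN.
  rewrite [RHS](split_pairs_swap b (fun x y => hcomp (aop_pos y) (curvature_action x))).
  apply: eq_bigr => p _.
  rewrite (split_pairs_swap p.2 (fun x y => comod_diff y (comod_diff x (aop_pos p.1)))).
  by rewrite (comod_sq hA)// opprK.
by rewrite addNr.
Qed.

(** D is a derivation of the composition. *)
Lemma endo_fun_mu1_mu2 d d' b rho tau : endo_homog d rho -> endo_homog d' tau ->
  endo_fun (endo_mu1 b (endo_mu2 rho tau)) + endo_fun (endo_mu2 (endo_mu1 b rho) tau)
   - (-1) ^ d *: endo_fun (endo_mu2 rho (endo_mu1 b tau)) = 0.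
Proof.
move=> hr ht; set r := endo_fun rho; set t := endo_fun tau.
pose z : K := (-1) ^ d; pose w : K := (-1) ^ d'.
have zz : z * z = 1 by exact: sign_sq.
have ww : w * w = 1 by exact: sign_sq.
have rl : multilinear r by exact: endo_fun_multilinear.
have tl : multilinear t by exact: endo_fun_multilinear.
have ml b' : multilinear (aop_pos b') := aop_pos_multilinear (A := A) b'.
rewrite (endo_fun_mu1_homog _ (endo_mu2_homog hr ht)) !endo_fun_mu2.
rewrite (endo_fun_sign (endo_mu1_homog b hr)) (endo_fun_sign hr) -/r -/t.
rewrite (endo_fun_mu1_homog _ hr) (endo_fun_mu1_homog _ ht) -/r -/t -/z -/w.
rewrite -!signD sign_inv sign_maslov mulr1 -/z -/w expr1z mulrN1.
rewrite !hcompZl !comodZ !hcompZr//.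
rewrite (comod_hcomp (g' := w *: t) b rl) => [|//|s]; last first.
  by rewrite -[RHS]endo_fun_signE (endo_fun_sign ht).
rewrite !hcompZr//; last exact: comod_multilinear.
move: (comod_diff b r) (comod_diff b t) => cr ct.
rewrite hcompDl hcompNl hcompZl hcompA0// hcompDr// hcompNr// hcompZr//.
rewrite !(scaleNr, scalerDr, scalerN, opprD, opprK, scalerA).
have -> : z * w * z = w by rewrite mulrAC zz mul1r.
rewrite ww zz mul1r !scale1r.
rewrite !addrA [LHS](AC 8 ((1*5)*(2*8)*(3*6)*(4*7))) /=.
by rewrite !subrr !addNr !addr0.
Qed.

Lemma endo_fun_mu2_assoc d d' rho tau sigma : endo_homog d rho -> endo_homog d' tau ->
  endo_fun (endo_mu2 (endo_mu2 rho tau) sigma)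
   = (-1) ^ d *: endo_fun (endo_mu2 rho (endo_mu2 tau sigma)).
Proof.
move=> hr ht; rewrite !endo_fun_mu2 (endo_fun_sign (endo_mu2_homog hr ht)) endo_fun_mu2.
rewrite (endo_fun_sign hr) (endo_fun_sign ht) -signD.
rewrite !(hcompZl, hcompZr) ?hcompA0//; [|exact: endo_fun_multilinear..].
rewrite !scalerA; congr (_ *: _); exact: mulrC.
Qed.

Lemma endo_op_high b (s : seq (EndA A)) : (2 < size s)%N -> aop (EndA A) b s = 0.
Proof. by case: s => [|? [|? [|? ?]]]. Qed.

(** Among four entries or more, the inner or the outer operation has at least three
    arguments. *)
Lemma bar_endo_high b b' (s : seq (EndA A)) : (3 < size s)%N ->
  bar_diff b (aop (EndA A) b') s = 0.
Proof.
move=> s3; rewrite /bar_diff big1// => i _; rewrite big1// => j ij.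
have [j3|j3] := ltnP 2 (size (take j (drop i s))).
  by rewrite (endo_op_high b j3) (multilin0 (aop_multilinear b')).
have li : (i <= size s)%N := leq_trans (leq_addr j i) ij.
have lj : (j <= size (drop i s))%N by rewrite size_drop leq_subRL.
apply: endo_op_high; rewrite size_cat /= size_map size_drop (size_takel li).
move: j3; rewrite (size_takel lj); move: (nat_of_ord i) (nat_of_ord j) ij => i' j'.
by move: (size s) s3 => n; lia.
Qed.

Lemma endo_mu1_0 b : endo_mu1 b (0 : endo A) = 0.
Proof.
have := endo_mu1_lin b (-1) (0 : endo A) 0.
by rewrite scaler0 addr0 scaleN1r addNr.
Qed.

Lemma endo_mu2_0l rho : endo_mu2 0 rho = 0.
Proof.
have := endo_mu2_linl (-1) (0 : endo A) 0 rho.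
by rewrite scaler0 addr0 scaleN1r addNr.
Qed.

Lemma endo_mu2_0r rho : endo_mu2 rho 0 = 0.
Proof.
have := endo_mu2_linr (-1) (0 : endo A) 0 rho.
by rewrite scaler0 addr0 scaleN1r addNr.
Qed.

Lemma endo_mu2_Zl c rho tau : endo_mu2 (c *: rho) tau = c *: endo_mu2 rho tau.
Proof. by rewrite -[c *: rho]addr0 endo_mu2_linl endo_mu2_0l addr0. Qed.

Lemma endo_ssign d rho : endo_homog d rho ->
  @ssign K (EndA A) rho = (-1) ^ (d - 1) *: rho.
Proof. by move=> h; exact: (@ssignE K (EndA A)). Qed.

Lemma EndA_rel b ds (s : seq (EndA A)) : homogs ds s ->
  bar_sum (aop (EndA A)) b ds s = 0.
Proof.
move=> hs; rewrite bar_sumE//; last exact: aop_multilinear.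
apply: endo_fun_inj; rewrite endo_fun_sum endo_fun0.
case: s ds hs => [|rho [|tau [|sigma [|x s]]]] ds hs; last first.
- by rewrite big1// => p _; rewrite bar_endo_high ?endo_fun0.
- case: ds hs => [[]|d [[_ []]|d' [[_ [_ []]]|d'' [[hr [ht [hs _]]]|? ? [_ [_ [_ []]]]]]]].
  rewrite (eq_bigr (fun p => if p.2 == dzero G then if p.1 == dzero G then
        endo_fun (endo_mu2 (endo_mu2 rho tau) sigma) +
        endo_fun (endo_mu2 (ssign (rho : EndA A)) (endo_mu2 tau sigma)) else 0 else 0)); last first.
    move=> p _; rewrite !bar_cons !hcomp_cons !hcomp_nil bar_nil !endo_funD /=.
    rewrite endo_mu1_0 !endo_fun0 !add0r !addr0.
    by case: (p.1 == _); case: (p.2 == _);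
      rewrite ?endo_mu2_0l ?endo_mu2_0r ?endo_mu1_0 ?endo_fun0 ?add0r ?addr0.
  rewrite (split_pairs_zeror b (fun x => if x == dzero G then
        endo_fun (endo_mu2 (endo_mu2 rho tau) sigma) +
        endo_fun (endo_mu2 (ssign (rho : EndA A)) (endo_mu2 tau sigma)) else 0)).
  case: eqP => // _; rewrite (endo_fun_mu2_assoc _ hr ht) (endo_ssign hr).
  by rewrite endo_mu2_Zl endo_funZ sign_pred scaleNr subrr.
- case: ds hs => [[]|d [[_ []]|d' [[hr [ht _]]|? ? [_ [_ []]]]]].
  rewrite (eq_bigr (fun p =>
      (if p.2 == dzero G then endo_fun (endo_mu2 (endo_mu1 p.1 rho) tau) else 0)
    + (if p.1 == dzero G then endo_fun (endo_mu1 p.2 (endo_mu2 rho tau)) else 0) +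
    (if p.2 == dzero G then
       endo_fun (endo_mu2 (ssign (rho : EndA A)) (endo_mu1 p.1 tau)) else 0))); last first.
    move=> p _; rewrite !bar_cons !hcomp_cons !hcomp_nil bar_nil !endo_funD /=.
    rewrite !endo_fun0 !add0r !addr0.
    by case: (p.1 == _); case: (p.2 == _);
      rewrite ?endo_mu2_0l ?endo_mu2_0r ?endo_mu1_0 ?endo_fun0 ?add0r ?addr0.
  rewrite !big_split /=.
  rewrite (split_pairs_zeror b (fun x => endo_fun (endo_mu2 (endo_mu1 x rho) tau))).
  rewrite (split_pairs_zerol b (fun x => endo_fun (endo_mu1 x (endo_mu2 rho tau)))).
  rewrite (split_pairs_zeror b
    (fun x => endo_fun (endo_mu2 (ssign (rho : EndA A)) (endo_mu1 x tau)))).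
  rewrite (endo_ssign hr) endo_mu2_Zl endo_funZ sign_pred scaleNr [X in X - _]addrC.
  exact: (endo_fun_mu1_mu2 b hr ht).
- case: ds hs => [[]|d [[hr _]|d' ds [_ []]]].
  rewrite (eq_bigr (fun p =>
    (if p.2 == dzero G then endo_fun (endo_mu2 (endo_mu0 A p.1) rho) else 0)
    + endo_fun (endo_mu1 p.2 (endo_mu1 p.1 rho)) +
    (if p.2 == dzero G then
       endo_fun (endo_mu2 (ssign (rho : EndA A)) (endo_mu0 A p.1)) else 0))); last first.
    move=> p _; rewrite bar_cons hcomp_cons hcomp_nil bar_nil !endo_funD /=.
    by case: eqP => _; rewrite ?endo_fun0.
  rewrite !big_split /=.
  rewrite (split_pairs_zeror b (fun x => endo_fun (endo_mu2 (endo_mu0 A x) rho))).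
  rewrite (split_pairs_zeror b
    (fun x => endo_fun (endo_mu2 (ssign (rho : EndA A)) (endo_mu0 A x)))).
  rewrite (endo_fun_mu1_mu1 b hr) !endo_fun_mu2 endo_fun_mu0.
  rewrite (endo_fun_sign (endo_mu0_homog b)) endo_fun_mu0.
  rewrite sign_curvature scale1r.
  have -> : endo_fun (endo_sign (ssign (rho : EndA A))) = - endo_fun rho.
    have := endo_sign_lin (-1) (endo_sign rho) 0.
    by rewrite endo_sign0 !addr0 !scaleN1r endo_signK => ->; exact: endo_funN.
  by rewrite hcompNl addrCA subrr addr0 subrr.
- rewrite -[RHS](endo_fun_mu1_mu0 b); apply: eq_bigr => p _.
  by rewrite (@bar_nil _ _ _ (EndA A)).
Qed.

(** There is no curvature of energy zero because m_{0,0} = 0 and zero has only the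
    trivial decomposition. *)
Lemma EndA_dg : is_filtered_dg (EndA A).
Proof.
split; [split|exact: endo_op_high|].
- move=> b ds [|rho [|tau [|sigma s]]].
  + case: ds => [_|? ? []]; rewrite big_nil;
    apply: (@homog_eqd K (EndA A) (2 - maslov b)); last exact: endo_mu0_homog.
    by rewrite /=; lia.
  + case: ds => [[]|d [[hr _]|? ? [_ []]]]; rewrite big_seq1.
    apply: (@homog_eqd K (EndA A) (d + (1 - maslov b))); last exact: endo_mu1_homog.
    by rewrite /=; lia.
  + case: ds => [[]|d [[_ []]|d' [[hr [ht _]]|? ? [_ [_ []]]]]].
    rewrite /=; case: eqP => [->|_]; last exact: (@homog0 K (EndA A)).
    apply: (@homog_eqd K (EndA A) (d + d')); last exact: endo_mu2_homog.
    by rewrite !big_cons big_nil /maslov /=; lia.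
  + by move=> _; rewrite endo_op_high//; exact: (@homog0 K (EndA A)).
- apply: endo_fun_inj.
  rewrite endo_fun0 endo_fun_mu0 /curvature_action big_split_pairs_dzero.
  rewrite /= (_ : curvature _ = 0) ?hcomp0r//; first exact: aop_pos_multilinear.
  by apply/funext => -[|//]; exact: aop00 hA.
- exact: EndA_rel.
- by move=> b [|rho [|tau [|? ?]]] //= _ /eqP/negPf ->.
Qed.

End DgAlgebra.

(** * Left multiplication as a homomorphism *)

Section Representation.
Variables (R : realType) (G : discreteSubmonoid R) (K : fieldType).
Variable A : unitalAinfty G K.
Local Notation m := (aop A).
Local Notation hA := (ua_ainfty A).
Local Notation aopl := (@aop_multilinear _ _ _ A).
Implicit Types (b : G) (a s t : seq A) (g : seq A -> A).

(** For empty [a] the formula would give the operations m_b(v, t) of the module A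
    itself; those act through mu_1 and not through the homomorphism. *)
Definition yoneda_family b a : A -> seq A -> A :=
  fun v t => if a is [::] then 0 else m b (a ++ v :: t).

(** Since [a] and the module variable are two entries already, a unit among the
    others occurs in an operation of arity at least three. *)
Lemma yoneda_homog b ds a : homogs ds a ->
  end_homog (\sum_(d <- ds) d + 1 - (size a)%:Z - maslov b) (yoneda_family b a).
Proof.
case: ds a => [|d ds] [|x a] //; first by move=> _; exact: end_homog0.
move=> h; split=> /=.
- by move=> s c y z; exact: (aopl b (x :: a)).
- by move=> v s1 s2 c y z; have := aopl b ((x :: a) ++ v :: s1) s2 c y z;
    rewrite /= -!catA.
- move=> v s es; apply: (aop_e0 (A := A)).
    by rewrite inE mem_cat inE es !orbT.
  by case: s es => // y s _; rewrite /= size_cat /=; lia.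
- move=> dv es v s hv hs.
  have := aop_degree hA b (homogs_cat h ((conj hv hs) : homogs (dv :: es) (v :: s))).
  apply: homog_eqd; rewrite big_cat !big_cons size_cat /=.
  move: (maslov b) (\sum_(j <- ds) j) (\sum_(j <- es) j) => u1 u2 u3; lia.
Qed.

Lemma yoneda_multilinear b : multilinear (yoneda_family b).
Proof.
move=> s1 s2 c x y; apply/funext => v; apply/funext => t.
rewrite !(fctD, fctZ) /yoneda_family.
have := aopl b s1 (s2 ++ v :: t) c x y.
by case: s1 => [|z s1]; rewrite /= -?catA.
Qed.

Lemma yoneda_closed b a : yoneda_family b a \in @end_pred _ _ _ A.
Proof.
apply: multilinear_closed; [exact: yoneda_multilinear|exact: end_submod_closed|].
by move=> ds s hs; exact: end_homog_pred (yoneda_homog b hs).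
Qed.

Definition yoneda b a : endo A := Endo (yoneda_closed b a).

Lemma yoneda_nil b : yoneda b [::] = 0.
Proof. exact: val_inj. Qed.

(** It agrees with [yoneda] except when [a] is empty, where it is the operation of the
    module A itself; with it, the two ends of the cut in [yoneda_rel] need no
    separate formula. *)
Definition partial_aop b a : seq A -> A := nonempty_part (fun t => m b (a ++ t)).

Lemma partial_aop_yoneda b a : a != [::] -> partial_aop b a = endo_fun (yoneda b a).
Proof. by case: a => // x a _; apply/funext => -[|v t]. Qed.

Lemma partial_aop_multilinear b a : multilinear (partial_aop b a).
Proof.
case: a => [|x a]; first exact: aop_pos_multilinear.
by rewrite partial_aop_yoneda//; exact: endo_fun_multilinear.
Qed.

Lemma endo_yoneda_multilinear b : multilinear (yoneda b).
Proof.
move=> s1 s2 c x y; apply: val_inj; rewrite endo_valP; exact: yoneda_multilinear.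
Qed.

Lemma endo_fun_bar_yoneda b b' a v t :
  endo_fun (bar_diff b (yoneda b') a) (v :: t) =
  bar_diff b (fun a' => m b' (a' ++ v :: t)) a.
Proof.
rewrite /bar_diff endo_fun_sum fct_sum; apply: eq_bigr => i _.
rewrite endo_fun_sum fct_sum; apply: eq_bigr => j _.
by case: (map _ _).
Qed.

(** The A-infinity relations on [a ++ v :: t], sorted by [bar_cat]. *)
Lemma yoneda_rel b a :
  \sum_(p <- split_pairs b) endo_fun (bar_diff p.1 (yoneda p.2) a) +
  \sum_(p <- split_pairs b) (\sum_(i < size a)
     hcomp (partial_aop p.2 (map (@ssign K A) (take i a))) (partial_aop p.1 (drop i a)) +
     comod_diff p.1 (partial_aop p.2 (map (@ssign K A) a))) = 0.
Proof.
apply/funext => -[|v t]; rewrite fctD !fct_sum.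
  rewrite !big1 ?addr0// => p _; rewrite fctD comod_nil addr0 fct_sum big1// => i _.
  by rewrite hcomp_nil; exact: (multilin0 (partial_aop_multilinear _ _) [::]).
have := congr1 (fun f : seq A -> A => f (a ++ v :: t)) (bar_aop hA b).
rewrite /= fct_sum => E; rewrite -[RHS]E -big_split; apply: eq_bigr => p _ /=.
rewrite bar_cat; last exact: aopl.
have /= <- := endo_fun_bar_yoneda p.1 p.2 a v t.
rewrite -addrA fctD fct_sum; congr (_ + (_ + _)).
by congr (_ (v :: t)); exact: comod_ext.
Qed.

Lemma yoneda_ssign b ds a : homogs ds a ->
  yoneda b (map (@ssign K A) a) = (-1) ^ (\sum_(d <- ds) (d - 1)) *: yoneda b a.
Proof.
move=> h; have := multilin_sgn (endo_yoneda_multilinear b) [::] [::] h.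
by rewrite !cats0.
Qed.

Lemma yoneda_degree b ds a : homogs ds a ->
  endo_homog (\sum_(d <- ds) d + 1 - (size a)%:Z - maslov b) (yoneda b a).
Proof. exact: yoneda_homog. Qed.

Lemma yoneda_sign b ds a : homogs ds a ->
  endo_fun (endo_sign (yoneda b a)) =
  - ((-1) ^ (\sum_(d <- ds) (d - 1)) *: endo_fun (yoneda b a)).
Proof.
move=> h; rewrite (endo_fun_sign (yoneda_degree b h)) -signD sign_inv sign_maslov mulr1.
rewrite -scaleNr signN sum_shifted (homogs_size h); congr (_ ^ _ *: _).
by move: (\sum_(d <- ds) d) => x; lia.
Qed.

(** In [yoneda_rel], the block that starts at the beginning of [a] and the blocks in
    [v :: t] make up mu_1, and the blocks that start at a later entry of [a] give
    the products. *)
Lemma yoneda_hom_rel b ds a : homogs ds a -> a != [::] ->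
  \sum_(p <- split_pairs b) endo_mu1 p.1 (yoneda p.2 a) +
  \sum_(i < (size a).-1) \sum_(p <- split_pairs b)
     endo_mu2 (yoneda p.1 (take i.+1 a)) (yoneda p.2 (drop i.+1 a))
  = \sum_(p <- split_pairs b) bar_diff p.1 (yoneda p.2) a.
Proof.
move=> h a0; apply: endo_fun_inj; rewrite endo_funD !endo_fun_sum.
have := yoneda_rel b a; set T := (X in _ + X) => E; apply: (addIr T); rewrite E {E}/T.
have -> : \sum_(p <- split_pairs b) (\sum_(i < size a)
     hcomp (partial_aop p.2 (map (@ssign K A) (take i a))) (partial_aop p.1 (drop i a)) +
     comod_diff p.1 (partial_aop p.2 (map (@ssign K A) a))) =
  \sum_(p <- split_pairs b) (hcomp (aop_pos p.1) (endo_fun (yoneda p.2 a)) +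
     comod_diff p.1 (endo_fun (yoneda p.2 (map (@ssign K A) a)))) +
  \sum_(i < (size a).-1) \sum_(p <- split_pairs b)
     hcomp (endo_fun (yoneda p.1 (map (@ssign K A) (take i.+1 a))))
       (endo_fun (yoneda p.2 (drop i.+1 a))).
  pose Y i x y := hcomp (endo_fun (yoneda x (map (@ssign K A) (take i a))))
    (endo_fun (yoneda y (drop i a))).
  rewrite (eq_bigr (fun p => (hcomp (aop_pos p.2) (endo_fun (yoneda p.1 a)) +
    \sum_(i < (size a).-1) Y i.+1 p.2 p.1) +
    comod_diff p.1 (endo_fun (yoneda p.2 (map (@ssign K A) a))))); last first.
    move=> p _; rewrite [in LHS]partial_aop_yoneda; last by case: (a) a0.
    congr (_ + _); rewrite /Y; case: (a) a0 => // x a' _.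
    rewrite [size _]/= big_ord_recl [drop ord0 _]drop0 (partial_aop_yoneda p.1)//.
    congr (_ + _).
    apply: eq_bigr => i _; rewrite !partial_aop_yoneda//.
    by rewrite -size_eq0 size_drop /= subn_eq0 -ltnNge ltnS.
  rewrite !big_split /=.
  rewrite (split_pairs_swap b (fun x y => hcomp (aop_pos y) (endo_fun (yoneda x a)))).
  rewrite addrAC -big_split; congr (_ + _).
  rewrite exchange_big /=; apply: eq_bigr => i _.
  exact: (split_pairs_swap b (fun x y => Y i.+1 y x)).
rewrite addrACA -!big_split /= [X in X + _]big1 ?add0r => [|p _]; last first.
  rewrite endo_fun_mu1 (yoneda_sign p.2 h) (yoneda_ssign p.2 h) endo_funZ comodN.
  by rewrite addrACA addNr add0r addNr.
rewrite big1// => i _; rewrite endo_fun_sum -big_split big1// => p _ /=.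
have hi := homogs_take i.+1 h.
by rewrite endo_fun_mu2 (yoneda_sign _ hi) (yoneda_ssign _ hi) endo_funZ hcompNl addNr.
Qed.

(** * The infinite sum in the relations of a homomorphism *)

Definition hom_indices b a : set (G * seq (G * seq A)) :=
  [set q | val q.1 + \sum_(p <- q.2) val p.1 = val b
           /\ flatten [seq p.2 | p <- q.2] = a].

Definition hom_term (q : G * seq (G * seq A)) : EndA A :=
  aop (EndA A) q.1 [seq (yoneda p.1 p.2 : EndA A) | p <- q.2].

Lemma hom_term0 q p : p \in q.2 -> p.2 = [::] -> hom_term q = 0.
Proof.
move=> pq p0; apply: (multilin0_in (aop_multilinear q.1)).
by apply/mapP; exists p => //; rewrite p0 yoneda_nil.
Qed.

(** Blocks without entries contribute 0, so only the term without blocks is left. *)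
Lemma hom_lhs_nil b : \sum_(q \in hom_indices b [::]) hom_term q = endo_mu0 A b.
Proof.
rewrite (fsbigE [:: (b, [::])])//=.
- rewrite big_mkcond big_seq1 ifT//.
  by apply/mem_set; split; rewrite //= big_nil addr0.
- by move=> q; rewrite /= inE => /eqP ->; split; rewrite //= big_nil addr0.
- move=> [x [|[y s] l]] [/= E1 E2] nq.
    move: nq; rewrite inE => /eqP[]; congr pair; apply: val_inj.
    by move: E1; rewrite big_nil addr0.
  apply: (@hom_term0 _ (y, s)); first by rewrite inE eqxx.
  by move: E2; case: (s).
Qed.

(** Blocks without entries contribute 0, and so do three blocks or more since End_A
    is a dg-algebra: there is one block, or there are two, cut after [i.+1] entries
    with [i.+1 < size a]. *)
Lemma hom_lhs_cons b a : a != [::] ->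
  \sum_(q \in hom_indices b a) hom_term q =
  \sum_(p <- split_pairs b) endo_mu1 p.1 (yoneda p.2 a) +
  \sum_(i < (size a).-1) \sum_(p <- split_pairs b)
     endo_mu2 (yoneda p.1 (take i.+1 a)) (yoneda p.2 (drop i.+1 a)).
Proof.
move=> a0.
pose q1 (p : G * G) : G * seq (G * seq A) := (p.1, [:: (p.2, a)]).
pose q2 (i : 'I_(size a).-1) (p : G * G) : G * seq (G * seq A) :=
  (dzero G, [:: (p.1, take i.+1 a); (p.2, drop i.+1 a)]).
pose L := [seq q1 p | p <- split_pairs b] ++
  [seq q2 i p | i <- index_enum 'I_(size a).-1, p <- split_pairs b].
have memL q : q \in L -> hom_indices b a q.
  rewrite mem_cat => /orP[/mapP|/allpairsP] [p].
    rewrite mem_split_pairs => /eqP pb ->; split; rewrite /= ?cats0//.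
    by rewrite big_seq1.
  rewrite mem_split_pairs => -[_ /eqP pb ->]; split; rewrite /= ?cats0 ?cat_take_drop//.
  by rewrite big_cons big_seq1 add0r.
have uL : uniq L.
  rewrite cat_uniq map_inj_uniq ?split_pairs_uniq /=; last by move=> [? ?] [? ?] [-> ->].
  apply/andP; split.
    apply/hasPn => q /allpairsP[p [_ _ ->]].
    by apply/mapP => -[p' _ []].
  apply: allpairs_uniq; rewrite ?index_enum_uniq ?split_pairs_uniq//.
  move=> [i [x y]] [i' [x' y']] _ _ [-> E -> _]; congr pair; apply: val_inj.
  have := congr1 size E; rewrite !size_takel; first by case.
    exact: leq_trans (ltn_ord _) (leq_pred _).
  exact: leq_trans (ltn_ord _) (leq_pred _).
have notL q : hom_indices b a q -> q \notin L -> hom_term q = 0.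
  case: q => x l [/= E1 E2] nq.
  have [/hasP[p pl /eqP p0]|/hasPn nl] := boolP (has (fun p => p.2 == [::]) l).
    exact: (hom_term0 (p := p)).
  case: l => [|[y s] [|[z t] [|u l]]] in E1 E2 nq nl *.
  - by rewrite -E2 eqxx in a0.
  - case/negP: nq; rewrite mem_cat; apply/orP; left; apply/mapP.
    exists (x, y); first by rewrite mem_split_pairs; apply/eqP; move: E1; rewrite big_seq1.
    by rewrite /q1 /= -E2 /= cats0.
  - case: (eqVneq x (dzero G)) => [x0|xn]; last first.
      by rewrite /hom_term /= (negPf xn).
    case/negP: nq; rewrite mem_cat; apply/orP; right; apply/allpairsP.
    rewrite /= cats0 in E2.
    have s0 := nl (y, s) (mem_head _ _).
    have t0 : t != [::] by apply: (nl (z, t)); rewrite !inE eqxx orbT.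
    have sa : ((size s).-1 < (size a).-1)%N.
      rewrite -E2 size_cat; move: s0 t0; rewrite /= -!size_eq0.
      by case: (size s) (size t) => [//|n] [//|k] _ _; rewrite addSn addnS /= ltnS leq_addr.
    exists (Ordinal sa, (y, z)); split; first by rewrite mem_index_enum.
      rewrite [_ \in _]mem_split_pairs; apply/eqP; move: E1.
      by rewrite x0 big_cons big_seq1 add0r.
    have ss : (size s).-1.+1 = size s by rewrite prednK// lt0n size_eq0.
    by rewrite /q2 /= ss -E2 take_size_cat// drop_size_cat// x0.
  - by rewrite /hom_term; apply: endo_op_high.
rewrite (fsbigE L hom_term uL memL notL) big_mkcond.
rewrite (eq_big_seq hom_term); last first.
  by move=> q /memL qQ; rewrite ifT//; exact/mem_set.
rewrite big_cat big_map big_allpairs_dep; congr (_ + _).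
by apply: eq_bigr => i _; apply: eq_bigr => p _; rewrite /hom_term /= eqxx.
Qed.

Lemma yoneda_hom_relation b ds a : homogs ds a ->
  \sum_(q \in hom_indices b a) hom_term q =
  bar_sum (fun b => yoneda b : seq A -> EndA A) b ds a.
Proof.
move=> h; rewrite bar_sumE//; last by move=> b'; exact: endo_yoneda_multilinear.
have [->|a0] := eqVneq a [::]; last by rewrite hom_lhs_cons// (yoneda_hom_rel _ h).
rewrite hom_lhs_nil; apply: endo_fun_inj; rewrite endo_fun_mu0 endo_fun_sum.
have := yoneda_rel b [::]; rewrite [X in _ + X](_ : _ = - curvature_action b).
  by move=> /eqP; rewrite subr_eq0 => /eqP <-.
rewrite -(comod_aop_pos hA b); apply: eq_bigr => p _.
by rewrite big_ord0 add0r.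
Qed.

Definition yoneda_hom : ainftyHom A (EndA A) :=
  @AinftyHom _ _ _ A (EndA A) (fun b => yoneda b : seq A -> EndA A)
    endo_yoneda_multilinear yoneda_degree (yoneda_nil _) yoneda_hom_relation.

End Representation.

Local Open Scope quotient_scope.

(** * A criterion for quasi-isomorphisms *)

Section Criterion.
Variables (R : realType) (G : discreteSubmonoid R) (K : fieldType).
Variables (A B : ainftyData G K) (F : ainftyHom A B).
Local Notation f z := (F (dzero G) [:: z]).
Hypothesis f_diff : forall z, adiff (f z) = f (adiff z).
Hypothesis f_surj : forall w, adiff w = 0 ->
  exists z b, adiff z = 0 /\ w = f z + adiff b.
Hypothesis f_inj : forall z b, adiff z = 0 -> f z = adiff b ->
  exists c, z = adiff c.

Lemma hom_linear c x y : f (c *: x + y) = c *: f x + f y.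
Proof. exact: (hmap_multilinear F (dzero G) [::] [::]). Qed.

Lemma hom_zero : f 0 = 0.
Proof. exact: (multilin0 (hmap_multilinear F (dzero G)) [::]). Qed.

Lemma cycleP (C : ainftyData G K) (z : cycles C) : adiff (val z) = 0.
Proof. by apply/eqP; case: z. Qed.

Fact hom_cycle (z : cycles A) : f (val z) \in @cycle_pred _ _ _ B.
Proof. by rewrite inE f_diff cycleP hom_zero. Qed.

Definition cycle_map (z : cycles A) : cycles B := Cycle (hom_cycle z).

Lemma class_eqP (C : ainftyData G K) (z w : cycles C) :
  (\pi_(cohomology C) z = \pi_(cohomology C) w) <->
  exists b, val z - val w = adiff b.
Proof.
split=> [/eqP|[b zw]].
  rewrite -Quotient.idealrBE => /asboolP[b zw]; exists b; rewrite -zw.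
  by rewrite raddfB.
by apply/eqP; rewrite -Quotient.idealrBE; apply/asboolP; exists b; rewrite raddfB.
Qed.

Definition cohomology_map (x : cohomology A) : cohomology B :=
  \pi_(cohomology B) (cycle_map (repr x)).

Lemma hom_sub x y : f (x - y) = f x - f y.
Proof.
by have := hom_linear (-1) y x; rewrite !scaleN1r addrC => ->; rewrite addrC.
Qed.

Lemma cohomology_mapE z :
  cohomology_map (\pi_(cohomology A) z) = \pi_(cohomology B) (cycle_map z).
Proof.
apply/class_eqP; have /class_eqP[b zb] :
  \pi_(cohomology A) (repr (\pi_(cohomology A) z)) = \pi_(cohomology A) z.
  exact: reprK.
by exists (f b); rewrite /= f_diff -zb hom_sub.
Qed.

Lemma cohomology_map_linear : linear cohomology_map.
Proof.
move=> c x y; have [z ->] := cohomologyP x; have [w ->] := cohomologyP y.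
have -> : c *: \pi_(cohomology A) z + \pi_(cohomology A) w =
  \pi_(cohomology A) (c *: z + w) by rewrite cohomologyD -cohomology_scaleE.
rewrite !cohomology_mapE.
have -> : cycle_map (c *: z + w) = c *: cycle_map z + cycle_map w.
  by apply: val_inj; rewrite /= hom_linear.
by rewrite cohomologyD -cohomology_scaleE.
Qed.

HB.instance Definition _ := GRing.isLinear.Build K (cohomology A) (cohomology B)
  _ cohomology_map cohomology_map_linear.

Lemma cohomology_map_bij : bijective cohomology_map.
Proof.
have surj y : exists x, cohomology_map x = y.
  have [w ->] := cohomologyP y.
  have [z [b [z0 wz]]] := f_surj (cycleP w).
  have zc : z \in @cycle_pred _ _ _ A by rewrite inE z0.
  exists (\pi_(cohomology A) (Cycle zc)); rewrite cohomology_mapE.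
  apply/class_eqP; exists (- b); rewrite wz /= opprD addNKr.
  by have := adiff_lin (-1) b 0; rewrite adiff0 !addr0 !scaleN1r.
have inj x x' : cohomology_map x = cohomology_map x' -> x = x'.
  have [z ->] := cohomologyP x; have [w ->] := cohomologyP x'.
  rewrite !cohomology_mapE => /class_eqP[b /= zw]; apply/class_eqP.
  apply: (f_inj (b := b)); last by rewrite hom_sub.
  by have := cycleP (z - w); rewrite raddfB.
have [g gK] : exists g, cancel g cohomology_map.
  by exists (fun y => sval (cid (surj y))) => y; case: cid.
by exists g => // x; apply: inj; rewrite gK.
Qed.

Lemma quasi_iso_criterion : is_quasi_iso F.
Proof.
exists (cohomology_map : {linear _ -> _}); last exact: cohomology_map_bij.
by move=> z; exists (cycle_map z) => //; exact: cohomology_mapE.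
Qed.

End Criterion.

(** * Evaluation at the unit *)

Section QuasiIso.
Variables (R : realType) (G : discreteSubmonoid R) (K : fieldType).
Variable A : unitalAinfty G K.
Local Notation m := (aop A).
Local Notation hA := (ua_ainfty A).
Local Notation e := (uaone A).
Local Notation dz := (dzero G).
Implicit Types (rho : endo A).

Definition eval_unit rho : A := val rho e [::].

(** The contracting homotopy: the unit is put into the place of the module variable,
    which becomes an ordinary entry. *)
Definition unit_shift_family (f : A -> seq A -> A) : A -> seq A -> A :=
  fun v t => f e (v :: t).

Lemma unit_shift_homog d f : end_homog (A := A) d f ->
  end_homog (A := A) (d - 1) (unit_shift_family f).
Proof.
move=> [l r r0 h]; split=> /=.
- by move=> s c x y; exact: (r e [::]).
- by move=> v s1; exact: (r e (v :: s1)).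
- by move=> v s es; apply: r0; rewrite inE es orbT.
- move=> dv ds v s hv hs.
  have := h 0 (dv :: ds) e (v :: s) (unit_degree (ua_unit A)) (conj hv hs).
  by apply: homog_eqd; rewrite big_cons /=; lia.
Qed.

Lemma unit_shift_closed rho : unit_shift_family (val rho) \in @end_pred _ _ _ A.
Proof.
elim/endo_ind: rho => [|c x y Hx Hy|d x hx].
- exact: (end_homog_pred (unit_shift_homog (end_homog0 A 0))).
- rewrite endo_valP.
  exact: (proj2 (end_submod_closed A)).
- exact: end_homog_pred (unit_shift_homog hx).
Qed.

Definition unit_shift rho : endo A := Endo (unit_shift_closed rho).

Lemma unit_shift_lin c x y : unit_shift (c *: x + y) = c *: unit_shift x + unit_shift y.
Proof.
apply: val_inj; rewrite [RHS]endo_valP.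
by rewrite -[LHS]/(unit_shift_family (val (c *: x + y))) endo_valP.
Qed.

Lemma unit_shift0 : unit_shift 0 = 0. Proof. exact: val_inj. Qed.

Lemma endo_sign_unit_shift rho : endo_sign (unit_shift rho) = - unit_shift (endo_sign rho).
Proof.
elim/endo_ind: rho => [|c x y Hx Hy|d x hx].
- by rewrite endo_sign0 unit_shift0 endo_sign0 oppr0.
- by rewrite unit_shift_lin !endo_sign_lin Hx Hy unit_shift_lin opprD scalerN.
- apply: val_inj.
  rewrite (@endo_signE _ _ _ A _ (unit_shift x) (unit_shift_homog hx)) sign_pred.
  apply/funext => v; apply/funext => t.
  by rewrite /= /unit_shift_family (endo_signE hx) scaleNr.
Qed.

Lemma curvature_dzero : curvature dz = 0 :> (seq A -> A).
Proof. by apply/funext => -[|//]; exact: aop00 hA. Qed.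

Lemma comod_dzero (V : lmodType K) (f : seq A -> V) : multilinear f ->
  comod_diff dz f = bar_diff dz f.
Proof. by move=> fl; rewrite /comod_diff curvature_dzero hcomp0r// subr0. Qed.

(** A nonempty prefix given to [rho] is the unit alone or contains [v]. *)
Lemma hcomp_unit rho v t : hcomp (aop_pos dz) (endo_fun rho) [:: e, v & t] =
  endo_fun (yoneda dz [:: eval_unit rho]) (v :: t) +
  hcomp (aop_pos dz) (endo_fun (unit_shift rho)) (v :: t).
Proof.
have m0 s : aop_pos dz (0 :: s) = 0 := multilin0 (aop_pos_multilinear _) [::] s.
by rewrite !hcomp_cons [endo_fun rho [::]]/= [endo_fun (unit_shift _) _]/= !m0 !add0r.
Qed.

(** Of the operations with the unit as first argument only m_2(e, v) = v survives; all
    other insertions leave the unit in place and are moved past it with the sign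
    of [ssign e = - e]. *)
Lemma comod_unit rho v t : comod_diff dz (endo_fun rho) [:: e, v & t] =
  endo_fun rho (v :: t) - comod_diff dz (endo_fun (unit_shift rho)) (v :: t).
Proof.
have rl := endo_fun_multilinear rho.
have r0 s : endo_fun rho (0 :: s) = 0 := multilin0 rl [::] s.
rewrite comod_cons// comod_dzero; last exact: endo_fun_multilinear.
congr (_ + _).
  rewrite !big_ord_recl [take ord0 _]/= aop_e0 ?mem_head// r0 add0r.
  rewrite [take _ _]/= [drop _ _]/= take0.
  rewrite (unit_mull (ua_unit A)) drop0 big1 ?addr0// => i _.
  by rewrite aop_e0 ?mem_head ?r0//; case: t i => [[]//|y t] i.
rewrite -[RHS]scaleN1r -[RHS]fctZ -barZ; congr (_ (v :: t)); apply: bar_ext => x s.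
by rewrite ssign_unit fctZ -scaleN1r (multilin_scale rl [::]).
Qed.

Lemma yoneda_homotopy rho : unit_shift (endo_mu1 dz rho) - endo_mu1 dz (unit_shift rho) =
  endo_sign rho - yoneda dz [:: eval_unit rho].
Proof.
apply: endo_fun_inj; apply/funext => -[|v t]; first by [].
rewrite !endo_funD !endo_funN !(fctD, fctN) endo_fun_mu1 endo_sign_unit_shift.
rewrite endo_funN comodN !(fctD, fctN).
rewrite -[endo_fun (unit_shift (endo_mu1 dz rho)) _]/(
  endo_fun (endo_mu1 dz rho) [:: e, v & t]).
rewrite endo_fun_mu1 fctD fctN hcomp_unit comod_unit.
have Z (x h s c : A) : - (x + h) + (s - c) - (- h - c) = s - x.
  rewrite !opprD !opprK !addrA [LHS](AC 6 (3*1*((2*5)*(4*6)))) /=.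
  by rewrite !addNr !addr0.
exact: Z.
Qed.

Lemma eval_unit_mu1 rho : eval_unit (endo_mu1 dz rho) = - adiff (eval_unit rho).
Proof.
rewrite -[LHS]/(endo_fun (endo_mu1 dz rho) [:: e]) endo_fun_mu1 fctD fctN.
rewrite comod_cons; last exact: endo_fun_multilinear.
rewrite big_ord_recl big_ord0 bar_nil [m dz [::]](aop00 hA).
rewrite [take ord0 _]/= [drop ord0 _]/= aop_e0 ?mem_head//.
have u0 := endo_fun_multilinear (endo_sign rho).
rewrite [endo_fun _ [:: 0]](multilin0 u0 [::]).
rewrite [endo_fun _ [:: _; 0]](multilin0 u0 [:: ssign e]).
rewrite !addr0 hcomp_cons hcomp_nil.
by rewrite [aop_pos dz [:: _; _]](multilin0 (aop_pos_multilinear dz) [::]) add0r.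
Qed.

Lemma eval_unit_yoneda (z : A) : eval_unit (yoneda dz [:: z]) = gsign z.
Proof. exact: unit_gsign. Qed.

Lemma yoneda_linear c (x y : A) :
  yoneda dz [:: c *: x + y] = c *: yoneda dz [:: x] + yoneda dz [:: y].
Proof. exact: (endo_yoneda_multilinear dz [::] [::]). Qed.

Lemma yoneda_zero : yoneda dz [:: 0 : A] = 0.
Proof. exact: (multilin0 (endo_yoneda_multilinear dz) [::] [::]). Qed.

Lemma yoneda_diff (z : A) : endo_mu1 dz (yoneda dz [:: z]) = yoneda dz [:: adiff z].
Proof.
elim/homog_ind: z => [|c x y Hx Hy|d x hx].
- by rewrite adiff0 yoneda_zero endo_mu1_0.
- by rewrite adiff_lin !yoneda_linear endo_mu1_lin Hx Hy.
have := @yoneda_hom_rel _ _ _ A dz [:: d] [:: x] (conj hx I) isT.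
rewrite !big_split_pairs_dzero big_ord0 addr0 /= => ->.
have rl := endo_yoneda_multilinear (A := A) dz.
rewrite bar_cons hcomp_cons hcomp_nil bar_nil [m dz [::]](aop00 hA).
by rewrite (multilin0 rl [::]) (multilin0 rl [:: _]) add0r addr0.
Qed.

Lemma gsign_adiff (C : ainftyData G K) (z : C) : is_filtered_ainfty C ->
  gsign (adiff z) = - adiff (gsign z).
Proof.
move=> hC; have := ssign_aop hC dz [:: z]; rewrite /= /ssign => /oppr_inj ->.
have := adiff_lin (-1) (gsign z) 0.
by rewrite adiff0 !addr0 !scaleN1r.
Qed.

Lemma gsignK (z : A) : gsign (gsign z) = z.
Proof. by rewrite -[RHS]ssignK /ssign -/(ssign _) ssignN opprK. Qed.

(** A cocycle [w] is cohomologous to the image of the value at the unit of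
    [endo_sign w]: this is the homotopy formula for [endo_sign w], which is again a
    cocycle. If the image of [z] is the coboundary of [rho], evaluation at the unit
    exhibits [z] as a coboundary. *)
Lemma yoneda_quasi_iso : is_quasi_iso (yoneda_hom A).
Proof.
have adiffN (C : ainftyData G K) (z : C) : adiff (- z) = - adiff z.
  by have := adiff_lin (-1) z 0; rewrite adiff0 !addr0 !scaleN1r.
apply: quasi_iso_criterion => /=.
- exact: yoneda_diff.
- move=> w w0; exists (eval_unit (endo_sign w)), (- unit_shift (endo_sign w)).
  have s0 : endo_mu1 dz (endo_sign w) = 0.
    have E := gsign_adiff (C := EndA A) w (dg_ainfty (EndA_dg A)).
    by apply: oppr_inj; rewrite oppr0 -[RHS](endo_sign0 A) -[in RHS]w0; exact/esym/E.
  split.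
    by apply: oppr_inj; rewrite -eval_unit_mu1 s0 /eval_unit oppr0.
  have := yoneda_homotopy (endo_sign w); rewrite s0 unit_shift0 add0r endo_signK.
  have -> : endo_mu1 dz (- unit_shift (endo_sign w)) =
    - endo_mu1 dz (unit_shift (endo_sign w)).
    exact: (adiffN (EndA A)).
  by move=> ->; rewrite addrC subrK.
- move=> z rho z0 zr; exists (- gsign (- eval_unit rho)).
  have := congr1 eval_unit zr; rewrite eval_unit_yoneda eval_unit_mu1 => E.
  rewrite -[LHS]gsignK E -adiffN gsign_adiff; last exact: hA.
  by rewrite adiffN.
Qed.

End QuasiIso.

Theorem corollary3p4 (R : realType) (G : discreteSubmonoid R) (K : fieldType)
    (A : unitalAinfty G K) :
  is_filtered_dg (EndA A) /\ quasi_isomorphic A (EndA A).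
Proof.
split; first exact: EndA_dg.
by exists (yoneda_hom A); exact: yoneda_quasi_iso.
Qed.
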